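(* Let $\mathcal{H}$ and $\mathcal{G}$ be real Hilbert spaces, let $L\in\mathcal{B}(\mathcal{H},\mathcal{G})$ be an isometry (i.e., $L^*\circ L=\mathrm{Id}_{\mathcal{H}}$), let $B\in\mathcal{S}(\mathcal{G})$, and let $\gamma\in\,]0,+\infty[$. For every $\mu\in\,]0,+\infty[$ and every $C\in\mathcal{S}(\mathcal{G})$, define $$\mathcal{L}_{\mu}(L,C)=\bigl(L^*\circ(C+\mu\,\mathrm{Id}_{\mathcal{G}})\circ L\bigr)\,\#\,\bigl(L^*\triangleright(C+\mu\,\mathrm{Id}_{\mathcal{G}})\bigr)-\mu\,\mathrm{Id}_{\mathcal{H}}$$ and $$\mathcal{L}_{-\mu}(L,C)=\bigl(\mathcal{L}_{\mu}(L,C^{-1})\bigr)^{-1}.$$ Then the following hold, where convergence is in the operator norm of $\mathcal{B}(\mathcal{H})$: (i) $L^*\triangleright B\preccurlyeq\mathcal{L}_{-\gamma}(L,B)\preccurlyeq L\overset{\gamma}{\bullet}B\preccurlyeq\mathcal{L}_{1/\gamma}(L,B)\preccurlyeq L^*\circ B\circ L$. (ii) $\mathcal{L}_{\gamma}(L,B)\to L^*\circ B\circ L$ as $\gamma\to+\infty$. (iii) $\mathcal{L}_{\gamma}(L,B)\to L^*\triangleright B$ as $\gamma\to-\infty$.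
   Context: $\mathcal{B}(\mathcal{H},\mathcal{G})$ is the space of bounded linear operators from $\mathcal{H}$ to $\mathcal{G}$ with the operator norm, $\mathcal{B}(\mathcal{H})=\mathcal{B}(\mathcal{H},\mathcal{H})$, and $L^*$ is the adjoint of $L$. $\mathcal{P}(\mathcal{H})$ is the set of self-adjoint $A\in\mathcal{B}(\mathcal{H})$ with $\langle Ax,x\rangle\geq 0$ for all $x\in\mathcal{H}$. For self-adjoint $A,B$, $A\preccurlyeq B$ means $B-A\in\mathcal{P}(\mathcal{H})$. $\mathcal{S}(\mathcal{H})$ is the set of $A\in\mathcal{P}(\mathcal{H})$ for which there exists $\alpha>0$ with $\alpha\,\mathrm{Id}_{\mathcal{H}}\preccurlyeq A$. For a set-valued operator $M\colon\mathcal{G}\to 2^{\mathcal{G}}$, $M^{-1}$ is the set-valued inverse ($x\in M^{-1}y\Leftrightarrow y\in Mx$); sums and compositions are taken in the set-valued sense, e.g. $(L^*\circ M\circ L)x=\{L^*y : y\in M(Lx)\}$; a set-valued operator all of whose values are singletons is identified with the corresponding single-valued operator. The parallel composition of $M$ by $L^*$ is $L^*\triangleright M=(L^*\circ M^{-1}\circ L)^{-1}$. For $\gamma\in\,]0,+\infty[$, the resolvent composition is $L\overset{\gamma}{\diamond}M=L^*\triangleright(M+\gamma^{-1}\mathrm{Id}_{\mathcal{G}})-\gamma^{-1}\mathrm{Id}_{\mathcal{H}}$, and the resolvent cocomposition is $L\overset{\gamma}{\bullet}M=\bigl(L\overset{1/\gamma}{\diamond}M^{-1}\bigr)^{-1}$.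 For $A,B\in\mathcal{S}(\mathcal{H})$, the geometric mean is $A\#B=A^{1/2}\circ\bigl(A^{-1/2}\circ B\circ A^{-1/2}\bigr)^{1/2}\circ A^{1/2}$, with real powers defined by the continuous functional calculus. *)

(* Defs.v *)
From HB Require Import structures.
From mathcomp Require Import all_boot all_order all_algebra.
From mathcomp Require Import all_classical all_reals all_analysis.

Set Implicit Arguments.
Unset Strict Implicit.
Unset Printing Implicit Defensive.

Import Order.TTheory GRing.Theory Num.Theory.
Import numFieldNormedType.Exports.

Local Open Scope classical_set_scope.
Local Open Scope ring_scope.

HB.mixin Record CompleteNormedModule_isHilbert (R : realType) (H : Type)
    & CompleteNormedModule R H := {
  inner : H -> H -> R ;
  innerC : forall x y, inner x y = inner y x ;
  innerPl : forall (a : R) x y z,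
    inner (a *: x + y) z = a * inner x z + inner y z ;
  inner_norm : forall x, inner x x = `|x| ^+ 2
}.

#[short(type="hilbertType")]
HB.structure Definition Hilbert (R : realType) :=
  {H of CompleteNormedModule_isHilbert R H & CompleteNormedModule R H}.

Section InnerProduct.
Variables (R : realType) (H : hilbertType R).

Lemma inner_bilinear : bilinear_for ( *%R : R -> R -> R)
  (idfun \; ( *%R : R -> R -> R)) (@inner R H).
Proof.
by split=> [z|z] a x y /=; rewrite ?(innerC z) innerPl.
Qed.

HB.instance Definition _ :=
  bilinear_isBilinear.Build R H H R *%R (idfun \; *%R) (@inner R H)
    inner_bilinear.

Lemma inner_hermitian (x y : H) : inner x y = (-1) ^+ false * idfun (inner y x).
Proof. by rewrite mul1r innerC. Qed.

HB.instance Definition _ :=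
  isHermitianSesquilinear.Build R H false idfun (@inner R H) inner_hermitian.

Lemma inner_gt0 (x : H) : x != 0 -> 0 < inner x x.
Proof. by move=> x0; rewrite inner_norm exprn_gt0// normr_gt0. Qed.

HB.instance Definition _ := isDotProduct.Build R H (@inner R H) inner_gt0.

End InnerProduct.

Section BoundedOperators.
Variables (R : realType) (H G : normedModType R).

Definition bounded_linear (f : H -> G) : Prop :=
  linear f /\ exists M : R, forall x, `|f x| <= M * `|x|.

Definition bounded_linear_pred : {pred H -> G} := mem [set f | bounded_linear f].

Record bop := BOp { bop_fun :> H -> G ; bopP : bop_fun \in bounded_linear_pred }.

HB.instance Definition _ := [isSub for bop_fun].
HB.instance Definition _ := [Choice of bop by <:].

Lemma bounded_linear_submod_closed : submod_closed bounded_linear_pred.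
Proof.
split.
  rewrite inE; split => [a x y|]; first by rewrite scaler0 addr0.
  by exists 0 => x; rewrite normr0 mul0r.
move=> a f g; rewrite !inE => -[lf [M Mf]] [lg [N Ng]]; split.
  move=> b x y; have -> z : (a *: f + g) z = a *: f z + g z by [].
  rewrite (lf b) (lg b) !scalerDr !scalerA [b * a]mulrC.
  by rewrite -!addrA; congr (_ + _); rewrite addrCA.
exists (`|a| * M + N) => x; have -> : (a *: f + g) x = a *: f x + g x by [].
rewrite (le_trans (ler_normD _ _))// mulrDl lerD// normrZ -mulrA.
by rewrite ler_wpM2l.
Qed.

HB.instance Definition _ := GRing.isSubmodClosed.Build R (H -> G)
  bounded_linear_pred bounded_linear_submod_closed.
HB.instance Definition _ := [SubChoice_isSubLmodule of bop by <:].

Lemma bop_linear (f : bop) : linear f.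
Proof. by have := bopP f; rewrite inE => -[]. Qed.

HB.instance Definition _ (f : bop) :=
  GRing.isLinear.Build R H G *:%R (bop_fun f) (bop_linear f).

Lemma bop_bounded (f : bop) : exists M : R, forall x, `|f x| <= M * `|x|.
Proof. by have := bopP f; rewrite inE => -[]. Qed.

Lemma bop_eqP (f g : bop) : (forall x, f x = g x) -> f = g.
Proof. by move=> fg; apply/val_inj/funext => x; exact: fg. Qed.

Definition opnorm (f : bop) : R := sup [set `|f x| | x in [set x | `|x| <= 1]].

Lemma opnorm_has_sup (f : bop) :
  has_sup [set `|f x| | x in [set x | `|x| <= 1]].
Proof.
split; first by exists `|f 0|; exists 0 => //=; rewrite normr0.
have [M Mf] := bop_bounded f; exists `|M| => _ [x /= x1 <-].
rewrite (le_trans (Mf x))// (le_trans (ler_wpM2r _ (ler_norm M)))//.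
by rewrite ler_piMr.
Qed.

Lemma opnorm_ub (f : bop) x : `|x| <= 1 -> `|f x| <= opnorm f.
Proof.
by move=> x1; apply: sup_upper_bound; [exact: opnorm_has_sup|exists x].
Qed.

Lemma opnorm_le (f : bop) M : (forall x, `|x| <= 1 -> `|f x| <= M) ->
  opnorm f <= M.
Proof.
move=> fM; apply: ge_sup; first exact: (opnorm_has_sup f).1.
by move=> _ [x /= x1 <-]; exact: fM.
Qed.

Lemma opnorm_ge0 (f : bop) : 0 <= opnorm f.
Proof. by rewrite (le_trans _ (@opnorm_ub f 0 _)) ?normr0. Qed.

Lemma opnormD (f g : bop) : opnorm (f + g) <= opnorm f + opnorm g.
Proof.
apply: opnorm_le => x x1; have -> : (f + g) x = f x + g x by [].
by rewrite (le_trans (ler_normD _ _))// lerD// opnorm_ub.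
Qed.

Lemma opnormZ_le (a : R) (f : bop) : opnorm (a *: f) <= `|a| * opnorm f.
Proof.
apply: opnorm_le => x x1; have -> : (a *: f) x = a *: f x by [].
by rewrite normrZ ler_wpM2l// opnorm_ub.
Qed.

Lemma opnormZ (a : R) (f : bop) : opnorm (a *: f) = `|a| * opnorm f.
Proof.
apply/eqP; rewrite eq_le opnormZ_le/=.
have [->|a0] := eqVneq a 0; first by rewrite normr0 mul0r opnorm_ge0.
have := opnormZ_le a^-1 (a *: f); rewrite scalerA mulVf// scale1r normfV.
by rewrite mulrC ler_pdivlMr ?normr_gt0// mulrC.
Qed.

Lemma opnorm0_eq0 (f : bop) : opnorm f = 0 -> f = 0.
Proof.
move=> f0; apply: bop_eqP => x; have -> : (0 : bop) x = 0 by [].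
have [->|x0] := eqVneq x 0; first by rewrite linear0.
have nx0 : `|x| != 0 by rewrite normr_eq0.
have x1 : `| `|x|^-1 *: x| <= 1 by rewrite normrZ normfV normr_id mulVf.
have := opnorm_ub f x1; rewrite f0 normr_le0 linearZ/= scaler_eq0 invr_eq0 (negbTE nx0)/=.
by move/eqP.
Qed.

HB.instance Definition _ :=
  Lmodule_isNormed.Build R bop opnormD opnormZ opnorm0_eq0.

End BoundedOperators.

Section Composition.
Variable R : realType.

Lemma bid_subproof (H : normedModType R) :
  (fun x : H => x) \in @bounded_linear_pred R H H.
Proof. by rewrite inE; split => //; exists 1 => x; rewrite mul1r. Qed.

Definition bid (H : normedModType R) : bop H H := BOp (bid_subproof H).

Lemma bcomp_subproof (H G K : normedModType R) (S : bop G K) (T : bop H G) :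
  (fun x => S (T x)) \in @bounded_linear_pred R H K.
Proof.
rewrite inE; split => [a x y|]; first by rewrite !linearP.
have [M MS] := bop_bounded S; have [N NT] := bop_bounded T.
exists (`|M| * N) => x; rewrite (le_trans (MS _))//.
by rewrite (le_trans (ler_wpM2r _ (ler_norm M)))// -mulrA ler_wpM2l.
Qed.

Definition bcomp (H G K : normedModType R) (S : bop G K) (T : bop H G)
  : bop H K := BOp (bcomp_subproof S T).

End Composition.

Notation "S \o_B T" := (bcomp S T)
  (at level 50, left associativity) : ring_scope.

Section Adjoint.
Variable R : realType.

(* Well defined by the Riesz representation theorem *)
Definition adjoint (H G : hilbertType R) (L : bop H G) : bop G H :=
  xget 0 [set T : bop G H | forall x y, inner (L x) y = inner x (T y)].

Variable H : hilbertType R.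

Definition selfadjoint (A : bop H H) : Prop := adjoint A = A.

Definition positive_op (A : bop H H) : Prop :=
  selfadjoint A /\ forall x, 0 <= inner (A x) x.

Definition loewner (A B : bop H H) : Prop :=
  [/\ selfadjoint A, selfadjoint B & positive_op (B - A)].

Definition strongly_positive_op (A : bop H H) : Prop :=
  positive_op A /\ exists2 alpha : R, 0 < alpha & loewner (alpha *: bid H) A.

End Adjoint.

Section FunctionalCalculus.
Variables (R : realType) (H : hilbertType R).

Definition spectrum (A : bop H H) : set R :=
  [set l | ~ exists T : bop H H,
     T \o_B (A - l *: bid H) = bid H /\ (A - l *: bid H) \o_B T = bid H].

Definition bpoly (p : {poly R}) (A : bop H H) : bop H H :=
  \sum_(i < size p) p`_i *: iter i (bcomp A) (bid H).

(* f(A) is the limit in operator norm of p_n(A) for polynomials p_n that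
   converge to f uniformly on the spectrum of A. It is meant for A self-adjoint
   and f continuous on the spectrum: since the spectrum of a self-adjoint
   operator on a real Hilbert space is real, real polynomials suffice. *)
Definition cfc (f : R -> R) (A : bop H H) : bop H H :=
  xget 0 [set T | exists p : nat -> {poly R},
    {uniform spectrum A, (fun n t => (p n).[t]) @ \oo --> f} /\
    bpoly (p n) A @[n --> \oo] --> T].

Definition opow (A : bop H H) (r : R) : bop H H := cfc (fun t => t `^ r) A.

Definition geomean (A B : bop H H) : bop H H :=
  opow A 2^-1
    \o_B opow (opow A (- 2^-1) \o_B B \o_B opow A (- 2^-1)) 2^-1
    \o_B opow A 2^-1.

End FunctionalCalculus.

Section SetValued.
Variable R : realType.

Definition svop (H G : Type) := H -> set G.

Definition sv_of (H G : normedModType R) (T : bop H G) : svop H G :=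
  fun x => [set T x].

Definition sv_inv (H G : Type) (M : svop H G) : svop G H :=
  fun y => [set x | M x y].

Definition sv_comp (H G K : Type) (N : svop G K) (M : svop H G) : svop H K :=
  fun x => \bigcup_(y in M x) N y.

Definition sv_add (H : Type) (G : zmodType) (M N : svop H G) : svop H G :=
  fun x => [set u + v | u in M x & v in N x].

(* The bounded operator with which a set-valued operator is identified, when
   there is one *)
Definition op_of (H G : normedModType R) (M : svop H G) : bop H G :=
  xget 0 [set T | sv_of T = M].

(* Loewner order through that identification: both sides must be (graphs of)
   self-adjoint bounded operators, so default values of op_of play no role *)
Definition sv_loewner (H : hilbertType R) (M N : svop H H) : Prop :=
  exists A B : bop H H, [/\ sv_of A = M, sv_of B = N & loewner A B].

Definition binv (H : normedModType R) (A : bop H H) : bop H H :=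
  op_of (sv_inv (sv_of A)).

Definition parallel_comp (H G : hilbertType R) (L : bop H G) (M : svop G G)
  : svop H H :=
  sv_inv (sv_comp (sv_of (adjoint L)) (sv_comp (sv_inv M) (sv_of L))).

Definition resolvent_comp (H G : hilbertType R) (gamma : R) (L : bop H G)
    (M : svop G G) : svop H H :=
  sv_add (parallel_comp L (sv_add M (sv_of (gamma^-1 *: bid G))))
         (sv_of (- (gamma^-1 *: bid H))).

Definition resolvent_cocomp (H G : hilbertType R) (gamma : R) (L : bop H G)
    (M : svop G G) : svop H H :=
  sv_inv (resolvent_comp gamma^-1 L (sv_inv M)).

End SetValued.

Section ResolventMean.
Variables (R : realType) (H G : hilbertType R).

Definition calL_pos (mu : R) (L : bop H G) (C : bop G G) : bop H H :=
  geomean (adjoint L \o_B (C + mu *: bid G) \o_B L)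
          (op_of (parallel_comp L (sv_of (C + mu *: bid G))))
  - mu *: bid H.

(* Only nonzero parameters are meaningful; the value at mu = 0 is junk *)
Definition calL (mu : R) (L : bop H G) (C : bop G G) : bop H H :=
  if 0 < mu then calL_pos mu L C else binv (calL_pos (- mu) L (binv C)).

End ResolventMean.

(* Main.v *)
(* Write [P = L* (C + mu) L] and [Q = (L* (C + mu)^-1 L)^-1]. For an isometry
   [L], [<(P - Q) x, x> = <(C + mu) w, w>] where [L x + w] is the minimizer of
   [<(C + mu) y, y>] over [L* y = x]; hence [0 <= P - Q <= |C|^2 / mu]. Since
   [Q <= P] implies [Q <= P # Q <= P], the mean [calL_pos mu L C] is squeezed
   between [Q - mu] and [L* C L], which gives the limit at +oo, and the limit at
   -oo by inversion. Because [L] is an isometry, the resolvent cocomposition of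
   [B] with parameter [gamma] equals [(L* (B + 1/gamma)^-1 L)^-1 - 1/gamma], so
   (i) is this squeeze for [B] together with its (order-reversed) inverse for
   [B^-1].

   The functional calculus rests on the bound of [|p(A)|] by the supremum of
   [|p|] over the spectrum of a symmetric [A]: for [c = |p(A)|], the operator
   [c^2 - p(A)^2] is not invertible, and factoring [c^2 - p^2] over the reals
   exhibits a spectral value [l] with [|p(l)| = c]. *)
Require Import Defs.
From mathcomp Require Import all_boot all_order all_algebra.
From mathcomp Require Import all_classical all_reals all_analysis.
From mathcomp Require Import complex ring lra.
Import Order.TTheory GRing.Theory Num.Theory.
Import numFieldNormedType.Exports.
Local Open Scope classical_set_scope.
Local Open Scope ring_scope.

Set Implicit Arguments.
Unset Strict Implicit.
Unset Printing Implicit Defensive.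

(** * Bounded operators and the operator norm *)

Section BoundedOperatorTheory.
Variables (R : realType) (H G : normedModType R).
Implicit Types (f g : bop H G) (a : R) (x y : H).

Lemma bopDE f g x : (f + g) x = f x + g x. Proof. by []. Qed.
Lemma bopNE f x : (- f) x = - f x. Proof. by []. Qed.
Lemma bopBE f g x : (f - g) x = f x - g x. Proof. by []. Qed.
Lemma bopZE a f x : (a *: f) x = a *: f x. Proof. by []. Qed.

Lemma bop_mapD f x y : f (x + y) = f x + f y. Proof. exact: linearD. Qed.
Lemma bop_mapN f x : f (- x) = - f x. Proof. exact: linearN. Qed.
Lemma bop_mapB f x y : f (x - y) = f x - f y. Proof. exact: linearB. Qed.
Lemma bop_mapZ f a x : f (a *: x) = a *: f x. Proof. exact: linearZ. Qed.

Lemma ler_norm_bop f x : `|f x| <= `|f| * `|x|.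
Proof.
have [->|x0] := eqVneq x 0; first by rewrite linear0 !normr0 mulr0.
have nx : 0 < `|x| by rewrite normr_gt0.
have : `|f (`|x|^-1 *: x)| <= `|f|.
  by apply: opnorm_ub; rewrite normrZ normfV normr_id mulVf ?gt_eqF.
by rewrite bop_mapZ normrZ normfV normr_id mulrC ler_pdivrMr.
Qed.

Lemma norm_bop_le f (M : R) : 0 <= M -> (forall x, `|f x| <= M * `|x|) ->
  `|f| <= M.
Proof.
move=> M0 fM; apply: opnorm_le => x x1; rewrite (le_trans (fM x))//.
by rewrite ler_piMr.
Qed.

End BoundedOperatorTheory.

Definition bopE := (bopDE, bopBE, bopNE, bopZE).

Lemma norm_bcomp (R : realType) (H G K : normedModType R) (S : bop G K)
  (T : bop H G) : `|S \o_B T| <= `|S| * `|T|.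
Proof.
apply: norm_bop_le => [|x]; first by rewrite mulr_ge0.
rewrite -mulrA; apply: le_trans (ler_norm_bop S (T x)) _.
by rewrite ler_wpM2l// ler_norm_bop.
Qed.

Lemma scalar_bopE (R : realType) (H : normedModType R) (a : R) (x : H) :
  (a *: bid H) x = a *: x.
Proof. by []. Qed.

(** * Inner product identities *)

Section InnerProductTheory.
Variables (R : realType) (H : hilbertType R).
Implicit Types x y z : H.

Lemma innerDl x y z : inner (x + y) z = inner x z + inner y z.
Proof. by rewrite -[x]scale1r innerPl mul1r scale1r. Qed.

Lemma inner0l y : inner 0 y = 0.
Proof. by apply: (addIr (inner 0 y)); rewrite -innerDl !add0r. Qed.

Lemma innerZl a x y : inner (a *: x) y = a * inner x y.
Proof. by rewrite -[a *: x]addr0 innerPl inner0l addr0. Qed.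

Lemma innerNl x y : inner (- x) y = - inner x y.
Proof. by rewrite -scaleN1r innerZl mulN1r. Qed.

Lemma innerBl x y z : inner (x - y) z = inner x z - inner y z.
Proof. by rewrite innerDl innerNl. Qed.

Lemma innerDr x y z : inner z (x + y) = inner z x + inner z y.
Proof. by rewrite !(innerC z) innerDl. Qed.

Lemma inner0r y : inner y 0 = 0. Proof. by rewrite innerC inner0l. Qed.

Lemma innerZr a x y : inner y (a *: x) = a * inner y x.
Proof. by rewrite !(innerC y) innerZl. Qed.

Lemma innerNr x y : inner y (- x) = - inner y x.
Proof. by rewrite !(innerC y) innerNl. Qed.

Lemma innerBr x y z : inner z (x - y) = inner z x - inner z y.
Proof. by rewrite !(innerC z) innerBl. Qed.

Definition innerE :=
  (innerDl, innerDr, innerBl, innerBr, innerNl, innerNr, innerZl, innerZr).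

Lemma inner_ge0 x : 0 <= inner x x.
Proof. by rewrite inner_norm sqr_ge0. Qed.

Lemma inner_inj x y : (forall z, inner x z = inner y z) -> x = y.
Proof.
move=> xy; apply/eqP; rewrite -subr_eq0 -normr_eq0 -sqrf_eq0 -inner_norm.
by rewrite innerBl xy subrr.
Qed.

End InnerProductTheory.

(** * Symmetric operators, their order, and inversion of coercive operators *)

Section LoewnerOrder.
Variables (R : realType) (H : hilbertType R).
Implicit Types (A B C S T : bop H H) (x y : H).

(** Stated without [adjoint], whose value is a choice with a default; [selfadjointP] gives the
    equivalence with [selfadjoint]. *)
Definition symmetric_op A := forall x y, inner (A x) y = inner x (A y).

Definition bop_le A B := forall x, inner (A x) x <= inner (B x) x.

Definition inverse_op A T := cancel A T /\ cancel T A.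

Lemma symmetric_bid : symmetric_op (bid H). Proof. by []. Qed.

Lemma symmetricD A B : symmetric_op A -> symmetric_op B -> symmetric_op (A + B).
Proof. by move=> sA sB x y; rewrite !bopE innerDl sA sB innerDr. Qed.

Lemma symmetricZ a A : symmetric_op A -> symmetric_op (a *: A).
Proof. by move=> sA x y; rewrite !bopE innerZl sA innerZr. Qed.

Lemma symmetricB A B : symmetric_op A -> symmetric_op B -> symmetric_op (A - B).
Proof. by move=> sA sB x y; rewrite !bopE innerBl sA sB innerBr. Qed.

Lemma symmetric_conj S T : symmetric_op S -> symmetric_op T ->
  symmetric_op (S \o_B T \o_B S).
Proof. by move=> sS sT x y /=; rewrite sS sT sS. Qed.

Lemma bop_le_trans B A C : bop_le A B -> bop_le B C -> bop_le A C.
Proof. by move=> AB BC x; exact: le_trans (AB x) (BC x). Qed.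

(** For [0 < c] the quadratic is evaluated at its minimizer [- b / c]. *)
Lemma sqr_le_of_quadratic_ge0 (a b c : R) : 0 <= c ->
  (forall t, 0 <= a + (t * b) *+ 2 + t ^+ 2 * c) -> b ^+ 2 <= a * c.
Proof.
rewrite le_eqVlt => /predU1P[<- abt|c0 abt].
  have [->|b0] := eqVneq b 0; first by rewrite mulr0 expr0n.
  (* With [c = 0] the expression is affine in [t], and this [t] makes it [-1]. *)
  have := abt (- (a + 1) / (b *+ 2)).
  have -> : a + (- (a + 1) / (b *+ 2) * b) *+ 2 +
    (- (a + 1) / (b *+ 2)) ^+ 2 * 0 = - 1 by field.
  by rewrite lerNr oppr0 ler10.
have := abt (- b / c).
have -> : a + (- b / c * b) *+ 2 + (- b / c) ^+ 2 * c = (a * c - b ^+ 2) / c.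
  by field; rewrite gt_eqF.
by rewrite pmulr_lge0 ?invr_gt0// subr_ge0.
Qed.

Lemma positive_cauchy_schwarz A x y : symmetric_op A -> bop_le 0 A ->
  inner (A x) y ^+ 2 <= inner (A x) x * inner (A y) y.
Proof.
move=> sA A0; have A0' z : 0 <= inner (A z) z by have := A0 z; rewrite inner0l.
apply: sqr_le_of_quadratic_ge0 => // t; have := A0' (x + t *: y).
rewrite bop_mapD bop_mapZ !innerE (sA y x) (innerC y).
by congr (_ <= _); ring.
Qed.

Lemma cauchy_schwarz x y : inner x y <= `|x| * `|y|.
Proof.
have := @positive_cauchy_schwarz (bid H) x y symmetric_bid.
have b0 : bop_le 0 (bid H) by move=> z; rewrite inner0l inner_ge0.
move=> /(_ b0); rewrite /= !inner_norm -exprMn => h.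
by rewrite (le_trans (ler_norm _))// -ler_sqr ?nnegrE ?mulr_ge0// real_normK ?num_real.
Qed.

Lemma bop_le_norm A : bop_le A (`|A| *: bid H).
Proof.
move=> x; rewrite bopE innerZl inner_norm.
rewrite (le_trans (cauchy_schwarz _ _))// expr2 mulrA ler_wpM2r//.
exact: ler_norm_bop.
Qed.

(** Cauchy-Schwarz for the form of [A] at [x] and [A x] gives [|A x|^4 <= <A x, x> <A (A x), A x> <=
    e^2 |x|^2 |A x|^2]. *)
Lemma norm_positive_le A (e : R) : 0 <= e -> symmetric_op A -> bop_le 0 A ->
  bop_le A (e *: bid H) -> `|A| <= e.
Proof.
move=> e0 sA A0 Ae; apply: norm_bop_le => // x.
have [->|Ax0] := eqVneq (A x) 0; first by rewrite normr0 mulr_ge0.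
have nAx : 0 < `|A x| by rewrite normr_gt0.
have A0' z : 0 <= inner (A z) z by have := A0 z; rewrite inner0l.
have Ae' z : inner (A z) z <= e * `|z| ^+ 2.
  by have := Ae z; rewrite bopE innerZl inner_norm.
have := @positive_cauchy_schwarz A x (A x) sA A0.
rewrite inner_norm => h.
have {}h : (`|A x| ^+ 2) ^+ 2 <= (e * `|x| ^+ 2) * (e * `|A x| ^+ 2).
  by apply: le_trans h _; apply: ler_pM.
rewrite -ler_sqr ?nnegrE ?mulr_ge0//.
rewrite -(ler_pM2r (exprn_gt0 2 nAx)) -expr2 (le_trans h)//.
by rewrite le_eqVlt; apply/orP; left; apply/eqP; ring.
Qed.

Lemma inverse_comp A B S T : inverse_op A S -> inverse_op B T ->
  inverse_op (A \o_B B) (T \o_B S).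
Proof. by move=> [AS SA] [BT TB]; split=> x /=; rewrite ?AS ?TB ?BT ?SA. Qed.

Lemma inverseZ a A T : a != 0 -> inverse_op A T ->
  inverse_op (a *: A) (a^-1 *: T).
Proof.
move=> a0 [AT TA]; split=> x; rewrite !bopE bop_mapZ scalerA ?AT ?TA.
  by rewrite mulVf// scale1r.
by rewrite mulfV// scale1r.
Qed.

Lemma inverse_symmetric A T : inverse_op A T -> symmetric_op A ->
  symmetric_op T.
Proof. by move=> [_ TA] sA x y; rewrite -{2}(TA x) sA TA. Qed.

(** Expanding [0 <= <A (S x - T x), S x - T x>] gives [2 <T x, x> <= <S x, x> + <A (T x), T x>], and
    the last term is at most [<B (T x), T x> = <T x, x>]. *)
Lemma inverse_antitone A B S T : symmetric_op A -> bop_le 0 A -> bop_le A B ->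
  inverse_op A S -> inverse_op B T -> bop_le T S.
Proof.
move=> sA A0 AB [_ SA] [_ TB] x; have := A0 (S x - T x); have := AB (T x).
rewrite inner0l bop_mapB SA TB !innerE (sA (T x) (S x)) SA.
by rewrite !(innerC x); lra.
Qed.

Lemma inverse_scalar a : a != 0 ->
  inverse_op (a *: bid H) (a^-1 *: bid H).
Proof. by move=> a0; apply: inverseZ. Qed.

Lemma bop_le_scalar a b : a <= b -> bop_le (a *: bid H) (b *: bid H).
Proof. by move=> ab x; rewrite !bopE !innerZl ler_wpM2r// inner_ge0. Qed.

Lemma coercive_positive a A : 0 <= a -> bop_le (a *: bid H) A -> bop_le 0 A.
Proof.
move=> a0; apply: bop_le_trans => x.
by rewrite inner0l bopE innerZl mulr_ge0// inner_ge0.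
Qed.

Lemma inverse_le_scalar a A T : 0 < a -> bop_le (a *: bid H) A ->
  inverse_op A T -> bop_le T (a^-1 *: bid H).
Proof.
move=> a0 aA AT; apply: (inverse_antitone _ _ aA) AT.
- exact: symmetricZ.
- by apply: (@coercive_positive a); rewrite ?ltW// => x.
- by apply: inverse_scalar; rewrite gt_eqF.
Qed.

Lemma scalar_le_inverse a A T : 0 < a -> symmetric_op A -> bop_le 0 A ->
  bop_le A (a *: bid H) -> inverse_op A T -> bop_le (a^-1 *: bid H) T.
Proof.
move=> a0 sA A0 Aa AT; apply: (inverse_antitone sA A0 Aa AT).
by apply: inverse_scalar; rewrite gt_eqF.
Qed.

Lemma coercive_lower_bound a A x : bop_le (a *: bid H) A ->
  a * `|x| <= `|A x|.
Proof.
move=> aA; have [->|x0] := eqVneq x 0; first by rewrite linear0 !normr0 mulr0.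
rewrite -(@ler_pM2r _ `|x|) ?normr_gt0//.
apply: le_trans (cauchy_schwarz (A x) x); have := aA x.
by rewrite bopE innerZl inner_norm expr2 mulrA.
Qed.

(* [x] solves [A x = y] iff it is a fixed point of [x - t (A x - y)], which is
   a contraction for [t = a / M ^ 2] when [a <= A] and [|A| <= M]. *)
Lemma coercive_surjective a A y : 0 < a -> bop_le (a *: bid H) A ->
  exists x, A x = y.
Proof.
move=> a0 aA; set M := `|A| + a; set t := a / M ^+ 2.
have M0 : 0 < M by rewrite ltr_wpDl.
have t0 : 0 < t by rewrite divr_gt0// exprn_gt0.
(* [|w - t A w|^2 <= (1 - 2 t a + t^2 M^2) |w|^2], and [t M^2 = a] turns the factor into [1 - t a].
   The summand [a] in [M] makes [M] positive and [t a <= 1]. *)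
pose q := Num.sqrt (1 - t * a).
have ta0 : 0 <= 1 - t * a.
  rewrite subr_ge0 /t mulrAC ler_pdivrMr ?exprn_gt0// mul1r -expr2.
  by rewrite ler_sqr ?nnegrE ?(ltW a0) ?(ltW M0)// lerDr.
have q0 : 0 <= q by rewrite sqrtr_ge0.
have q1 : q < 1.
  by rewrite -sqrtr1 ltr_sqrt// ltrBlDr ltrDl mulr_gt0.
have qE : q ^+ 2 = 1 - t * a by rewrite sqr_sqrtr.
pose f (x : H) := x - t *: (A x - y).
have fD u v : f u - f v = (u - v) - t *: A (u - v).
  rewrite /f opprB [t *: _ - v]addrC addrACA [- (t *: _) + _]addrC -scalerBr.
  by rewrite opprB addrA subrK bop_mapB -scalerN opprB.
have fq u v : `|f u - f v| <= q * `|u - v|.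
  rewrite fD; move: (u - v) => w.
  rewrite -ler_sqr ?nnegrE ?mulr_ge0// exprMn qE -!inner_norm !innerE.
  have h1 : a * inner w w <= inner (A w) w.
    by have := aA w; rewrite bopE innerZl.
  have h2 : inner (A w) (A w) <= M ^+ 2 * inner w w.
    rewrite !inner_norm -exprMn ler_sqr ?nnegrE ?mulr_ge0//; last exact: ltW.
    by rewrite (le_trans (ler_norm_bop A w))// ler_wpM2r// lerDl ltW.
  have h3 : t * (t * inner (A w) (A w)) <= t * (a * inner w w).
    rewrite ler_pM2l//; apply: le_trans (ler_wpM2l (ltW t0) h2) _.
    by rewrite mulrA /t mulfVK// expf_neq0// gt_eqF.
  have h4 : t * (a * inner w w) <= t * inner (A w) w by rewrite ler_pM2l.
  rewrite (innerC w); lra.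
have fT : {homo f : x / setT x >-> setT x} by [].
have ctr : is_contraction (mkfun_fun fT : {fun setT >-> setT}).
  exists (NngNum q0); split=> //= -[u v] _ /=; exact: fq.
have [||x _ xf] := banach_fixed_point ctr; [exact: closedT|by exists 0|].
exists x; apply/subr0_eq; apply: (scalerI (lt0r_neq0 t0)).
rewrite scaler0; apply: oppr_inj; apply: (addrI x); rewrite oppr0 addr0.
exact: esym xf.
Qed.

(** The lower bound [a |x| <= |A x|] makes preimages unique, so choosing them is linear, and bounds
    the resulting inverse by [a^-1]. *)
Lemma coercive_inverse a A : 0 < a -> bop_le (a *: bid H) A ->
  exists T, inverse_op A T.
Proof.
move=> a0 aA; have [T AT] := choice (fun y => coercive_surjective y a0 aA).
have A_inj x y : A x = A y -> x = y.
  move=> Axy; apply/subr0_eq/normr0_eq0/eqP; rewrite eq_le normr_ge0 andbT.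
  rewrite -(ler_pM2l a0) mulr0 (le_trans (coercive_lower_bound _ aA))//.
  by rewrite bop_mapB Axy subrr normr0.
have bT : T \in @bounded_linear_pred R H H.
  rewrite inE; split=> [c x y|].
    by apply: A_inj; rewrite AT bop_mapD bop_mapZ !AT.
  exists a^-1 => x; rewrite -(ler_pM2l a0) mulrA mulfV ?gt_eqF// mul1r.
  by rewrite (le_trans (coercive_lower_bound _ aA))// AT.
exists (BOp bT); split=> x /=; last exact: AT.
by apply: A_inj; rewrite AT.
Qed.

End LoewnerOrder.

(** * Adjoints and the translation of [loewner] into quadratic forms *)

Section Adjoints.
Variable R : realType.

Definition adjoint_pair (H G : hilbertType R) (L : bop H G) (T : bop G H) :=
  forall x y, inner (L x) y = inner x (T y).

Lemma adjoint_pair_uniq (H G : hilbertType R) (L : bop H G) (S T : bop G H) :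
  adjoint_pair L S -> adjoint_pair L T -> S = T.
Proof.
move=> LS LT; apply: bop_eqP => y; apply: inner_inj => z.
by rewrite !(innerC _ z) -LS -LT.
Qed.

Lemma adjointE (H G : hilbertType R) (L : bop H G) (T : bop G H) :
  adjoint_pair L T -> adjoint L = T.
Proof.
move=> LT; apply: xget_unique => // S LS; exact: adjoint_pair_uniq LS LT.
Qed.

(* If no adjoint existed, the default value 0 of [adjoint L] would force
   [bid H = 0], and 0 is an adjoint when [H] is trivial. *)
Lemma isometry_adjoint (H G : hilbertType R) (L : bop H G) :
  adjoint L \o_B L = bid H -> adjoint_pair L (adjoint L).
Proof.
case: (pselect (exists T, adjoint_pair L T)) => [[T LT] _|noT].
  by rewrite (adjointE LT).
rewrite /adjoint xgetPN => [L0|T LT]; last by apply: noT; exists T.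
have H0 (x : H) : x = 0 by have := congr1 (fun T : bop H H => T x) L0.
by move=> x y; rewrite (H0 x) linear0 !inner0l.
Qed.

Lemma selfadjointP (H : hilbertType R) (A : bop H H) :
  selfadjoint A <-> symmetric_op A.
Proof.
split=> [|sA]; last exact: adjointE.
(* If no adjoint exists, [adjoint A] is the default 0, so [A = 0], which is symmetric. *)
rewrite /selfadjoint /adjoint; case: xgetP => [T _ LT TA|_ <-] x y; first by rewrite -{2}TA.
by rewrite inner0l inner0r.
Qed.

Lemma loewnerP (H : hilbertType R) (A B : bop H H) :
  loewner A B <-> [/\ symmetric_op A, symmetric_op B & bop_le A B].
Proof.
split=> [[/selfadjointP sA /selfadjointP sB [_ AB]]|[sA sB AB]].
  by split=> // x; have := AB x; rewrite bopE innerBl subr_ge0.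
split; [exact/selfadjointP|exact/selfadjointP|split=> [|x]].
  exact/selfadjointP/symmetricB.
by rewrite bopE innerBl subr_ge0; exact: AB.
Qed.

End Adjoints.

(** * Completeness of the space of bounded operators *)

Section Completeness.
Variables (R : realType) (H G : completeNormedModType R).

(** The limit is taken pointwise. The estimate [|u n x - u m x| <= e |x|] survives [m -> oo]
    uniformly in [x], which yields both the boundedness of the limit and convergence in norm. *)
Lemma bop_cauchy_cvg (u : nat -> bop H G) :
  (forall e, 0 < e -> exists N, forall n m, (N <= n)%N -> (N <= m)%N ->
    `|u n - u m| <= e) ->
  exists T : bop H G, u n @[n --> \oo] --> T.
Proof.
move=> uC.
have ux e : 0 < e -> exists N, forall x n m, (N <= n)%N -> (N <= m)%N ->
    `|u n x - u m x| <= e * `|x|.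
  move=> /uC[N uN]; exists N => x n m Nn Nm; rewrite -bopBE.
  by rewrite (le_trans (ler_norm_bop _ _))// ler_wpM2r// uN.
have cx x : cvgn (u ^~ x).
  apply/cauchy_cvgP/cauchy_exP => e e0.
  have [N uN] := ux (e / (`|x| + 1)) (divr_gt0 e0 (ltr_pwDr ltr01 (normr_ge0 x))).
  exists (u N x); exists N => // n /= Nn; rewrite -ball_normE /=.
  apply: le_lt_trans (uN _ _ _ (leqnn N) Nn) _.
  by rewrite mulrAC ltr_pdivrMr ?ltr_pwDr// ltr_pM2l// ltrDl.
have [T Tu] : exists T : H -> G, forall x, u n x @[n --> \oo] --> T x.
  by exists (fun x => limn (u ^~ x)).
have uT e : 0 < e -> exists N, forall n, (N <= n)%N -> forall x,
    `|u n x - T x| <= e * `|x|.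
  move=> /ux[N uN]; exists N => n Nn x.
  have h : `|u n x - u m x| @[m --> \oo] --> `|u n x - T x|.
    by apply: cvg_norm; apply: cvgB => //; exact: cvg_cst.
  have near_le : \forall m \near \oo, [set z | z <= e * `|x|] `|u n x - u m x|.
    by exists N => // m Nm; exact: uN.
  exact: (@closed_cvg _ _ _ _ _ _ (@closed_le R (e * `|x|)) near_le _ h).
have bT : T \in @bounded_linear_pred R H G.
  rewrite inE; split=> [c x y|].
    have h : u n (c *: x + y) @[n --> \oo] --> c *: T x + T y.
      under eq_fun do rewrite bop_mapD bop_mapZ.
      by apply: cvgD => //; apply: cvgZr.
    exact: cvg_unique (Tu _) h.
  have [N uN] := uT 1 ltr01; exists (`|u N| + 1) => x.
  have -> : T x = u N x - (u N x - T x) by rewrite opprB addrC subrK.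
  rewrite (le_trans (ler_normB _ _))// mulrDl lerD ?ler_norm_bop//.
  exact: uN.
exists (BOp bT); apply/cvgrPdist_le => e e0.
have [N uN] := uT e e0; exists N => // n /= Nn.
apply: norm_bop_le => [|x]; first exact: ltW.
by rewrite distrC; exact: uN.
Qed.
End Completeness.

(** A complex root [a + i b] exists. If [b] is nonzero, the remainder of [q] modulo
    [(X - a)^2 + b^2] has degree at most 1 and vanishes at [a + i b]; the imaginary part kills its
    leading coefficient, then the real part its constant one. *)
Lemma real_poly_factor (R : rcfType) (q : {poly R}) : (1 < size q)%N ->
  (exists a, root q a) \/
  exists a b, b != 0 /\ ('X - a%:P) ^+ 2 + (b ^+ 2)%:P %| q.
Proof.
move=> q1; pose qC := map_poly (real_complex R) q.
have : size qC != 1%N by rewrite size_map_poly gtn_eqF.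
case/closed_rootP => -[a b] rz.
have [b0|b0] := eqVneq b 0.
  left; exists a; move: rz; rewrite b0 -[(a +i* 0)%C]/(real_complex R a).
  by rewrite fmorph_root.
right; exists a, b; split=> //.
set Q : {poly R} := _ + _.
have QE : Q = 'X^2 - (a *+ 2) *: 'X + (a ^+ 2 + b ^+ 2)%:P.
  by rewrite /Q rmorphD /= -mul_polyC rmorphMn /= rmorphXn /=; ring.
have sQ : size Q = 3.
  rewrite QE -addrA size_polyDl ?size_polyXn// ltnS.
  rewrite (leq_trans (size_polyD _ _))// geq_max size_polyN.
  by rewrite (leq_trans (size_scale_leq _ _)) ?size_polyX// ?(leq_trans (size_polyC_leq1 _)).
have Q0 : Q != 0 by rewrite -size_poly_gt0 sQ.
set r := q %% Q.
have sr : (size r <= 2)%N by rewrite -ltnS (leq_trans _ (eq_leq sQ))// ltn_modp.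
have rz0 : (map_poly (real_complex R) r).[(a +i* b)%C] = 0.
  move: rz; rewrite /root /qC (divp_eq q Q) rmorphD rmorphM /= hornerD hornerM.
  rewrite -/r => /eqP; suff -> : (map_poly (real_complex R) Q).[(a +i* b)%C] = 0.
    by rewrite mulr0 add0r.
  rewrite /Q rmorphD rmorphXn rmorphB /= map_polyX !map_polyC /= !hornerE.
  by apply/eqP; rewrite eq_complex /=; apply/andP; split; apply/eqP; ring.
move: rz0; rewrite (@horner_coef_wide _ 2) ?size_map_poly//.
rewrite !big_ord_recl big_ord0 /= !coef_map /= => /eqP.
rewrite eq_complex /= => /andP[/eqP re /eqP im].
rewrite -[bump 0 0]/1%N in re im.
have r1 : r`_1 = 0.
  by apply/eqP; rewrite -(mulIr_eq0 _ (mulIf b0)) -[X in _ == X]im; apply/eqP; ring.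
have r0 : r`_0 = 0 by rewrite -[RHS]re r1; ring.
rewrite /dvdp -/r; apply/eqP/polyP => -[|[|i]]; rewrite coef0//.
by rewrite nth_default// (leq_trans sr).
Qed.

(** * Polynomials of an operator and their norm in terms of the spectrum *)

Section PolynomialCalculus.
Variables (R : realType) (H : hilbertType R) (A : bop H H).
Implicit Types (p q : {poly R}) (x : H).

(** The free bound [n] lets polynomials of different sizes share one range of summation. *)
Lemma bpolyE n p x : (size p <= n)%N ->
  bpoly p A x = \sum_(i < n) p`_i *: iter i A x.
Proof.
move=> pn; have -> : bpoly p A x = \sum_(i < size p) p`_i *: iter i A x.
  rewrite /bpoly (big_morph (fun T : bop H H => T x) (id1 := 0) (op1 := +%R))//.
  apply: eq_bigr => i _; rewrite bopZE; congr (_ *: _).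
  by elim: (i : nat) => //= k <-.
rewrite (big_ord_widen n (fun i => p`_i *: iter i A x) pn) big_mkcond/=.
apply: eq_bigr => i _; case: ltnP => // ip.
by rewrite nth_default// scale0r.
Qed.

Lemma bpolyD p q x : bpoly (p + q) A x = bpoly p A x + bpoly q A x.
Proof.
pose n := maxn (size p) (size q).
rewrite (@bpolyE n) ?size_polyD// (@bpolyE n p) ?leq_maxl//.
rewrite (@bpolyE n q) ?leq_maxr// -big_split/=.
by apply: eq_bigr => i _; rewrite coefD scalerDl.
Qed.

Lemma bpolyZ c p x : bpoly (c *: p) A x = c *: bpoly p A x.
Proof.
rewrite !(@bpolyE (size p)) ?size_scale_leq// scaler_sumr.
by apply: eq_bigr => i _; rewrite coefZ scalerA.
Qed.

Lemma bpolyC c x : bpoly c%:P A x = c *: x.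
Proof. by rewrite (@bpolyE 1) ?size_polyC_leq1// big_ord1 coefC. Qed.

Lemma bpolyMX p x : bpoly (p * 'X) A x = bpoly p A (A x).
Proof.
rewrite (@bpolyE (size p).+1) ?(@bpolyE (size p))//; last first.
  by rewrite (leq_trans (size_polyMleq _ _))// size_polyX addn2.
rewrite big_ord_recl coefMX scale0r add0r; apply: eq_bigr => i _.
by rewrite coefMX /= -iterSr.
Qed.

Lemma bpoly_comm p x : A (bpoly p A x) = bpoly p A (A x).
Proof.
rewrite !(@bpolyE (size p))// linear_sum/=; apply: eq_bigr => i _.
by rewrite bop_mapZ -iterS iterSr.
Qed.

Lemma bpolyM p q x : bpoly (p * q) A x = bpoly p A (bpoly q A x).
Proof.
elim/poly_ind: p x => [|p c IHp] x.
  by rewrite mul0r -polyC0 !bpolyC !scale0r.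
by rewrite mulrDl bpolyD mulrAC bpolyMX IHp bpolyD bpolyMX mul_polyC bpolyZ
  bpolyC bpoly_comm.
Qed.

Lemma bpolyX x : bpoly 'X A x = A x.
Proof. by rewrite -['X]mul1r bpolyMX -polyC1 bpolyC scale1r. Qed.

Lemma bpolyN p x : bpoly (- p) A x = - bpoly p A x.
Proof. by rewrite -scaleN1r bpolyZ scaleN1r. Qed.

Lemma bpolyB p q x : bpoly (p - q) A x = bpoly p A x - bpoly q A x.
Proof. by rewrite bpolyD bpolyN. Qed.

Lemma spectrumP l :
  ~ spectrum A l <-> exists T, inverse_op (A - l *: bid H) T.
Proof.
split=> [/contrapT[T [TA AT]]|[T [AT TA]] nT].
  exists T; split=> x.
    exact: (congr1 (fun S : bop H H => S x) TA).
  exact: (congr1 (fun S : bop H H => S x) AT).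
by apply: nT; exists T; split; apply: bop_eqP => x; [exact: AT|exact: TA].
Qed.

Hypothesis sA : symmetric_op A.

Lemma bpoly_symmetric p : symmetric_op (bpoly p A).
Proof.
elim/poly_ind: p => [|p c IHp] x y.
  by rewrite -polyC0 !bpolyC !scale0r inner0l inner0r.
by rewrite !bpolyD !bpolyMX !bpolyC !innerE -bpoly_comm sA IHp.
Qed.

(** For [l < a] the operator [A - l] is coercive with constant [a - l], hence invertible. *)
Lemma spectrum_coercive a l : bop_le (a *: bid H) A -> spectrum A l -> a <= l.
Proof.
move=> aA; rewrite leNgt; apply: contraPN => la; apply/spectrumP.
apply: (@coercive_inverse _ _ (a - l)) => [|x]; first by rewrite subr_gt0.
by have := aA x; rewrite !bopE !innerE /=; lra.
Qed.

Lemma spectrum_le_bound a l : bop_le A (a *: bid H) -> spectrum A l -> l <= a.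
Proof.
move=> Aa; rewrite leNgt; apply: contraPN => la; apply/spectrumP.
have [||T [LT TL]] := @coercive_inverse _ _ (l - a) (l *: bid H - A).
- by rewrite subr_gt0.
- by move=> x; have := Aa x; rewrite !bopE !innerE /=; lra.
exists (- T); have hA x : (A - l *: bid H) x = - (l *: bid H - A) x.
  by rewrite !bopE opprB.
split=> x; first by rewrite bopNE hA bop_mapN opprK LT.
by rewrite hA bopNE bop_mapN opprK TL.
Qed.

(* Real roots of [q] are handled by the spectrum; conjugate pairs of nonreal
   roots yield coercive factors [(A - a)^2 + b^2]. *)
Lemma bpoly_inverse q : q != 0 -> (forall l, spectrum A l -> q.[l] != 0) ->
  exists T, inverse_op (bpoly q A) T.
Proof.
have [n] := ubnP (size q); elim: n q => // n IHn q; rewrite ltnS => qn q0 qA.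
have [q1|q1] := leqP (size q) 1.
  have [c qE] : exists c, q = c%:P by exists q`_0; exact: size1_polyC.
  have c0 : c != 0 by rewrite -polyC_eq0 -qE.
  exists (c^-1 *: bid H); split=> x; rewrite qE bopZE bpolyC scalerA.
    by rewrite mulVf// scale1r.
  by rewrite mulfV// scale1r.
(* It suffices to split off a nonconstant factor that is invertible at [A]: the cofactor is smaller
   and still has no zero on the spectrum. *)
suff [f [r [fr f1 [T fT]]]] : exists f r, [/\ q = r * f, (1 < size f)%N &
    exists T, inverse_op (bpoly f A) T].
  have r0 : r != 0 by apply: contraNneq q0 => r0; rewrite fr r0 mul0r.
  have f0 : f != 0 by rewrite -size_poly_gt0 ltnW.
  have [|l Al|S rS] := IHn r _ r0.
  - rewrite (leq_trans _ qn)// fr size_mul//.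
    by case: (size f) f1 => [|[|k]]// _; rewrite !addnS /= ltnS leq_addr.
  - by have := qA _ Al; rewrite fr hornerM mulf_eq0 => /norP[].
  exists (T \o_B S); have := inverse_comp rS fT.
  by rewrite fr; congr inverse_op; apply: bop_eqP => x /=; rewrite bpolyM.
have [[a /factor_theorem[r qr]]|[a [b [b0 /dvdpP[r qr]]]]] := real_poly_factor q1.
  exists ('X - a%:P), r; split=> //; first by rewrite size_XsubC.
  have /spectrumP[T AT] : ~ spectrum A a.
    by move=> /qA; rewrite qr hornerM hornerXsubC subrr mulr0 eqxx.
  exists T; congr (inverse_op _ T): AT.
  by apply: bop_eqP => x; rewrite bpolyB bpolyX bpolyC.
exists (('X - a%:P) ^+ 2 + (b ^+ 2)%:P), r; split=> //.
  rewrite size_polyDl ?size_exp_XsubC// ltnS.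
  by rewrite (leq_trans (size_polyC_leq1 _)).
apply: (@coercive_inverse _ _ (b ^+ 2)) => [|x].
  by rewrite exprn_even_gt0.
have sp := bpoly_symmetric ('X - a%:P).
rewrite bpolyD [('X - _) ^+ 2]expr2 bpolyM bpolyC innerDl sp lerDr.
exact: inner_ge0.
Qed.

(* The inverse would make [c^2 - T^2] bounded below, forcing
   [|T x| <= d |x|] for some [d < c]. *)
Lemma norm_sqr_sub_not_inverse (T V : bop H H) : symmetric_op T -> 0 < `|T| ->
  ~ inverse_op (`|T| ^+ 2 *: bid H - (T \o_B T)) V.
Proof.
move=> sT; set c := `|T|; set q := _ - _ => c0 [qV Vq].
have qE x : q x = c ^+ 2 *: x - T (T x) by [].
pose K := `|V| + 1; have K0 : 0 < K by rewrite ltr_pwDr.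
(* [|x| <= K |q x|] since [V] inverts [q]. Expanding [|q x|^2] gives
   [c^4 |x|^2 - 2 c^2 |T x|^2 + |T (T x)|^2], whose last term is at most [c^2 |T x|^2]. *)
have low x : `|x| ^+ 2 <= K ^+ 2 * (c ^+ 2 * (c ^+ 2 * `|x| ^+ 2 - `|T x| ^+ 2)).
  have h1 : `|x| ^+ 2 <= K ^+ 2 * `|q x| ^+ 2.
    rewrite -exprMn ler_sqr ?nnegrE ?mulr_ge0 ?(ltW K0)// -{1}(qV x).
    by rewrite (le_trans (ler_norm_bop _ _))// ler_wpM2r// lerDl.
  apply: le_trans h1 _; rewrite ler_pM2l ?exprn_gt0//.
  rewrite -inner_norm qE !innerE (sT (T x) x) (innerC x (T (T x))) sT !inner_norm.
  have : `|T (T x)| ^+ 2 <= c ^+ 2 * `|T x| ^+ 2.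
    by rewrite -exprMn ler_sqr ?nnegrE ?mulr_ge0 ?ler_norm_bop// ltW.
  lra.
pose d2 := c ^+ 2 - (K ^+ 2 * c ^+ 2)^-1.
have Kc : 0 < K ^+ 2 * c ^+ 2 by rewrite mulr_gt0// exprn_gt0.
have up x : `|T x| ^+ 2 <= d2 * `|x| ^+ 2.
  rewrite /d2 mulrBl lerBrDr -lerBrDl ler_pdivrMl//.
  by rewrite (le_trans (low x))// mulrA.
have d2c : d2 < c ^+ 2 by rewrite ltrBlDr ltrDl invr_gt0.
(* A negative [d2] has no square root to serve as a norm bound, but then [up] forces [T = 0],
   against [0 < c]. *)
have [d0|d0] := leP 0 d2.
  have : c <= Num.sqrt d2.
    apply: norm_bop_le => [|x]; first exact: sqrtr_ge0.
    by rewrite -ler_sqr ?nnegrE ?mulr_ge0 ?sqrtr_ge0// exprMn sqr_sqrtr.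
  by rewrite leNgt -(@ltr_sqr _ _ c) ?nnegrE ?sqrtr_ge0 ?(ltW c0)// sqr_sqrtr// d2c.
have : c <= 0.
  apply: norm_bop_le => // x; rewrite mul0r -(@ler_sqr _ _ 0) ?nnegrE// expr0n.
  by rewrite (le_trans (up x))// nmulr_rle0// sqr_ge0.
by rewrite leNgt c0.
Qed.

(** [bpoly_inverse] needs a nonzero polynomial; the case where [p] is one of the constants plus or
    minus [|p(A)|] is treated apart in [norm_bpoly_le]. *)
Lemma norm_bpoly_spectrum p : 0 < `|bpoly p A| ->
  (`|bpoly p A| ^+ 2)%:P - p ^+ 2 != 0 ->
  exists2 l, spectrum A l & p.[l] ^+ 2 = `|bpoly p A| ^+ 2.
Proof.
set c := `|_| => c0 q0; apply: contrapT => nA.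
have [l Al|V] := bpoly_inverse q0.
  apply: contra_notN nA; rewrite !hornerE subr_eq0 => /eqP pl.
  by exists l.
have -> : bpoly ((c ^+ 2)%:P - p ^+ 2) A = c ^+ 2 *: bid H - (bpoly p A \o_B bpoly p A).
  by apply: bop_eqP => x; rewrite bpolyB bpolyC expr2 bpolyM.
apply: norm_sqr_sub_not_inverse => //; exact: bpoly_symmetric.
Qed.

(** [norm_bpoly_spectrum] is applied to [X] when [A] is nonzero and to [X + 1], whose value is the
    identity, when [A = 0]. Both have degree 1, so their squares are not constant. *)
Lemma spectrum_nonempty : (exists x : H, x != 0) -> spectrum A !=set0.
Proof.
move=> [x x0].
have h p : (size p = 2)%N -> 0 < `|bpoly p A| -> spectrum A !=set0.
  move=> p2 p0; have [|l Al _] := norm_bpoly_spectrum p0; last by exists l.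
  rewrite subr_eq0; apply/eqP => /(congr1 (fun p : {poly R} => (size p).-1)).
  rewrite size_exp p2; have := size_polyC_leq1 (`|bpoly p A| ^+ 2).
  by case: (size _) => [|[|k]].
have [A0|A0] := eqVneq A 0; last first.
  apply: (h 'X); first by rewrite size_polyX.
  by rewrite normr_gt0; apply: contra_neq A0 => XA; apply: bop_eqP => y; rewrite -bpolyX XA.
apply: (h ('X - (-1)%:P)); first by rewrite size_XsubC.
rewrite normr_gt0; apply: contra_neq x0 => XA.
have := congr1 (fun T : bop H H => T x) XA.
rewrite bpolyB bpolyX bpolyC A0 scaleN1r opprK => Ax.
by rewrite -[LHS]add0r; exact: Ax.
Qed.

Lemma norm_bpoly_le p (e : R) : 0 <= e ->
  (forall l, spectrum A l -> `|p.[l]| <= e) -> `|bpoly p A| <= e.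
Proof.
move=> e0 pe; rewrite leNgt; apply/negP; set c := `|_| => ec.
have c0 : 0 < c by exact: le_lt_trans ec.
have pc l : spectrum A l -> p.[l] ^+ 2 != c ^+ 2.
  move=> /pe pl; rewrite lt_eqF// -real_normK ?num_real//.
  by rewrite ltr_sqr ?nnegrE// ?(ltW c0)// (le_lt_trans pl).
(* If [p ^ 2] is the constant [c ^ 2], any spectral value gives the contradiction; there is one,
   since [0 < c] excludes the trivial space. *)
have [q0|/(norm_bpoly_spectrum c0)[l /pc/eqP//]] := eqVneq ((c ^+ 2)%:P - p ^+ 2) 0.
have [|l Al] := spectrum_nonempty.
  apply: contrapT => H0; move: c0; rewrite normr_gt0 => /eqP; apply.
  apply: bop_eqP => x; apply/eqP; rewrite -[X in _ == X](linear0 (bpoly p A)).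
  apply/eqP; congr (bpoly p A _); apply/eqP; apply: contra_notT H0 => x0.
  by exists x.
have := congr1 (horner^~ l) q0; rewrite !hornerE => /eqP.
by rewrite subr_eq0 eq_sym; apply/negP/pc.
Qed.

End PolynomialCalculus.

(** * Uniform polynomial approximation in epsilon form *)

Section UniformApproximation.
Variable R : realType.
Implicit Types (S : set R) (p : nat -> {poly R}) (f : R -> R).

Definition uniform_approx S p f := forall e, 0 < e -> exists N,
  forall n, (N <= n)%N -> forall t, S t -> `|f t - (p n).[t]| <= e.

Lemma uniform_approxP S p f :
  {uniform S, (fun n t => (p n).[t]) @ \oo --> f} <-> uniform_approx S p f.
Proof.
split=> [pf e e0|pf P].
  have /pf[N _ NP] : nbhs (f : {uniform` S -> R})
      [set h | forall t, S t -> `|f t - h t| < e].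
    apply/uniform_nbhs; exists [set xy | ball xy.1 e xy.2]; split=> //.
    exact: (entourage_ball R (PosNum e0)).
  by exists N => n /NP /= + t St => /(_ t St) /ltW.
move=> /uniform_nbhs[E [entE EP]].
move: entE; rewrite -entourage_ballE => -[e /= e0 eE].
have [N Np] := pf _ (divr_gt0 e0 (ltr0n R 2)).
exists N => // n /= Nn; apply: EP => t St; apply: eE; rewrite /= /ball /=.
by rewrite (le_lt_trans (Np n Nn t St))// ltr_pdivrMr// ltr_pMr// ltr1n.
Qed.

Lemma eq_uniform_approx S p f g : (forall t, S t -> f t = g t) ->
  uniform_approx S p f -> uniform_approx S p g.
Proof.
move=> fg pf e /pf[N Np]; exists N => n Nn t St; rewrite -fg//; exact: Np.
Qed.

Lemma uniform_approx_sub S S' p f : S `<=` S' ->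
  uniform_approx S' p f -> uniform_approx S p f.
Proof.
by move=> SS' pf e /pf[N Np]; exists N => n Nn t /SS'; exact: Np.
Qed.

Lemma uniform_approxMX S p f (K : R) : (forall t, S t -> `|t| <= K) ->
  uniform_approx S p f ->
  uniform_approx S (fun n => 'X * p n) (fun t => t * f t).
Proof.
move=> SK pf e e0; pose K' := `|K| + 1.
have K0 : 0 < K' by rewrite ltr_pwDr.
have [N Np] := pf _ (divr_gt0 e0 K0); exists N => n Nn t St.
rewrite hornerM hornerX -mulrBr normrM -[e](divfK (lt0r_neq0 K0)) mulrC.
apply: ler_pM => //; first exact: Np.
by rewrite (le_trans (SK _ St))// (le_trans (ler_norm K))// lerDl.
Qed.

(** Serves to pass to the limit in approximations; the restriction [e <= 1] lets terms quadratic in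
    [e] be absorbed into [c]. *)
Lemma le0_of_small (a c : R) :
  (forall e, 0 < e -> e <= 1 -> a <= e * c) -> a <= 0.
Proof.
move=> h; rewrite leNgt; apply/negP => a0.
have ac : a <= c by rewrite -[c]mul1r h.
have c0 : 0 < c by exact: lt_le_trans ac.
(* Since [a <= c], this [e] is at most 1/2, and it would give [a <= a / 2]. *)
have := h (a / (c *+ 2)); rewrite divr_gt0 ?mulrn_wgt0// => /(_ isT).
rewrite ler_pdivrMr ?mulrn_wgt0// mul1r.
have -> : a / (c *+ 2) * c = a / 2.
  by field; rewrite lt0r_neq0.
have -> : a <= c *+ 2 by rewrite mulr2n; lra.
by move=> /(_ isT); lra.
Qed.

End UniformApproximation.

(** * Continuous functional calculus of a symmetric operator *)

Section ContinuousFunctionalCalculus.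
Variables (R : realType) (H : hilbertType R) (A : bop H H).
Hypothesis sA : symmetric_op A.
Implicit Types (f g : R -> R) (S T : bop H H).

Definition is_cfc f T := exists p, uniform_approx (spectrum A) p f /\
  forall e, 0 < e -> exists N, forall n, (N <= n)%N -> `|T - bpoly (p n) A| <= e.

Lemma is_cfc_approx f T e : is_cfc f T -> 0 < e -> exists p : {poly R},
  `|T - bpoly p A| <= e /\ forall l, spectrum A l -> `|f l - p.[l]| <= e.
Proof.
move=> [p [pf pT]] e0; have [[N Np] [M Mp]] := (pf e e0, pT e e0).
exists (p (maxn N M)); split; first by rewrite Mp ?leq_maxr.
by move=> l; apply: Np; rewrite leq_maxl.
Qed.

(** By [norm_bpoly_le] the operators [bpoly (p n) A] form a Cauchy sequence, so a limit exists and
    the default value in [cfc] is not taken. *)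
Lemma cfcP f : (exists p, uniform_approx (spectrum A) p f) ->
  is_cfc f (cfc f A).
Proof.
move=> [p pf]; rewrite /cfc; case: xgetP => [T _ [q [/uniform_approxP qf qT]]|].
  exists q; split=> // e e0; move/cvgrPdist_le: qT => /(_ e e0)[N _ Nq].
  by exists N => n; exact: Nq.
have [|T pT] := @bop_cauchy_cvg R H H (fun n => bpoly (p n) A).
  move=> e e0; have [N Np] := pf _ (divr_gt0 e0 (ltr0n R 2)).
  exists N => n m Nn Nm.
  have -> : bpoly (p n) A - bpoly (p m) A = bpoly (p n - p m) A.
    by apply: bop_eqP => x; rewrite bpolyB.
  apply: norm_bpoly_le => // [|l Al]; first exact: ltW.
  rewrite hornerD hornerN (splitr e) (le_trans (ler_distD (f l) _ _))//.
  by rewrite lerD ?Np// distrC Np.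
by move=> /(_ T); case; exists p; split=> //; exact/uniform_approxP.
Qed.

Lemma is_cfc_symmetric f T : is_cfc f T -> symmetric_op T.
Proof.
move=> fT; suff h x y : inner (T x) y - inner x (T y) <= 0.
  move=> x y; apply/eqP; rewrite -subr_eq0 eq_le h/=.
  by rewrite -oppr_le0 opprB innerC (innerC (T x)) h.
apply: (@le0_of_small _ _ (`|x| * `|y| *+ 2)) => e e0 _.
have [p [pT _]] := is_cfc_approx fT e0; set P := bpoly p A in pT.
have sP : symmetric_op P by exact: bpoly_symmetric.
have -> : inner (T x) y - inner x (T y) =
    inner ((T - P) x) y + inner x ((P - T) y).
  by rewrite !bopBE !innerE sP; ring.
rewrite mulrnAr mulr2n lerD// (le_trans (cauchy_schwarz _ _))//.
  by rewrite mulrA ler_wpM2r// (le_trans (ler_norm_bop _ _))// ler_wpM2r.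
rewrite mulrCA ler_wpM2l// (le_trans (ler_norm_bop _ _))// ler_wpM2r//.
by rewrite distrC.
Qed.

(** The product of the functions is only required to agree with a polynomial on the spectrum, which
    covers [t^(1/2) t^(1/2) = t] and [t^(1/2) t^(-1/2) = 1]. *)
Lemma is_cfc_mul f g S T (h : {poly R}) (K : R) :
  is_cfc f S -> is_cfc g T ->
  (forall l, spectrum A l -> [/\ `|f l| <= K, `|g l| <= K & f l * g l = h.[l]]) ->
  S \o_B T = bpoly h A.
Proof.
move=> fS gT fgh; apply/eqP; rewrite -subr_eq0 -normr_le0; apply/eqP.
have -> : (`|S \o_B T - bpoly h A| <= 0) = true; last by [].
pose K' := `|K| + 1; have K0 : 0 < K' by rewrite ltr_pwDr.
apply: (@le0_of_small _ _ (`|T| + (`|S| + 1) + (K' + K'))) => e e0 e1.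
have [p [pS pf]] := is_cfc_approx fS e0.
have [q [qT qg]] := is_cfc_approx gT e0.
have -> : S \o_B T - bpoly h A = ((S - bpoly p A) \o_B T) +
    (bpoly p A \o_B (T - bpoly q A)) + bpoly (p * q - h) A.
  by apply: bop_eqP => x; rewrite !bopE /= bpolyB bpolyM bop_mapB !subrKA.
rewrite mulrDr (mulrDr _ `|T|).
rewrite (le_trans (ler_normD _ _))// lerD//.
  rewrite (le_trans (ler_normD _ _))// lerD//.
    by rewrite (le_trans (norm_bcomp _ _))// ler_wpM2r.
  rewrite (le_trans (norm_bcomp _ _))// mulrC ler_pM//.
  rewrite -[bpoly p A](subrK S) (le_trans (ler_normD _ _))// addrC lerD//.
  by rewrite distrC (le_trans pS).
apply: norm_bpoly_le => // [|l Al]; first by rewrite ltW// mulr_gt0// addr_gt0.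
have [fK gK fg] := fgh _ Al; rewrite hornerD hornerN hornerM -fg.
have -> : p.[l] * q.[l] - f l * g l =
    - ((f l - p.[l]) * q.[l]) - f l * (g l - q.[l]) by ring.
have KK' : `|K| <= K' by rewrite lerDl.
rewrite (le_trans (ler_normB _ _))// normrN !normrM mulrDr lerD//.
  apply: ler_pM => //; first exact: pf.
  have -> : q.[l] = g l - (g l - q.[l]) by ring.
  rewrite (le_trans (ler_normB _ _))// lerD ?(le_trans (qg _ Al))//.
  by rewrite (le_trans gK)// ler_norm.
rewrite mulrC; apply: ler_pM => //; first exact: qg.
by rewrite (le_trans fK)// (le_trans (ler_norm _)).
Qed.

(** A norm bound becomes positivity by a shift: on the spectrum [|K| - p] is at most [|K| + e] in
    absolute value, so [|K| - p(A) <= |K| + e], that is [p(A) >= - e]. *)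
Lemma is_cfc_ge0 f T (K : R) : is_cfc f T ->
  (forall l, spectrum A l -> 0 <= f l <= K) -> bop_le 0 T.
Proof.
move=> fT f0K x; rewrite inner0l -oppr_le0.
apply: (@le0_of_small _ _ (`|x| ^+ 2 *+ 2)) => e e0 _.
have [p [pT pf]] := is_cfc_approx fT e0.
have nP : `|bpoly (`|K|%:P - p) A| <= `|K| + e.
  apply: norm_bpoly_le => // [|l Al]; first exact: addr_ge0 (normr_ge0 K) (ltW e0).
  rewrite hornerD hornerC hornerN ler_norml.
  have := pf _ Al; have := f0K _ Al; have := ler_norm K; rewrite ler_norml.
  by move=> ? /andP[? ?] /andP[? ?]; apply/andP; split; lra.
have h1 : inner (bpoly (`|K|%:P - p) A x) x <= (`|K| + e) * `|x| ^+ 2.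
  have := bop_le_norm (bpoly (`|K|%:P - p) A) x.
  move=> /le_trans; apply; rewrite bopZE innerZl inner_norm.
  by rewrite ler_wpM2r ?sqr_ge0.
have h2 : - inner ((T - bpoly p A) x) x <= e * `|x| ^+ 2.
  have := bop_le_norm (bpoly p A - T) x.
  rewrite -innerNl -bopNE opprB => /le_trans; apply.
  by rewrite bopZE innerZl inner_norm ler_wpM2r ?sqr_ge0// distrC.
move: h1 h2; rewrite bpolyB bpolyC !bopBE !innerE inner_norm; lra.
Qed.

End ContinuousFunctionalCalculus.

(** * Polynomial approximation of the inverse square root *)

Section SquareRoot.
Variable R : realType.

Lemma ler_of_sqr (x y : R) : 0 <= y -> x ^+ 2 <= y ^+ 2 -> x <= y.
Proof.
move=> y0 xy; have [x0|/ltW/le_trans] := leP 0 x; last exact.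
by rewrite -ler_sqr ?nnegrE.
Qed.

(** Reduces both real powers to one positive number [r] with [t r^2 = 1], so that later computations
    are algebraic. *)
Lemma powR_halfN (t : R) : 0 < t ->
  let r := t `^ (- 2^-1) in [/\ 0 < r, t * r ^+ 2 = 1 & t `^ 2^-1 = t * r].
Proof.
move=> t0 r; have t1 : t `^ 2^-1 = t * r.
  rewrite -{2}(powRr1 (ltW t0)) /r -powRD; last by rewrite (lt0r_neq0 t0) implybT.
  by congr (_ `^ _); lra.
split=> //; first exact: powR_gt0.
rewrite expr2 mulrA -t1 -powRD; last by rewrite (lt0r_neq0 t0) implybT.
by rewrite subrr powRr0.
Qed.

(* Fixed-step iteration for the root of [1 - t v^2]: the error is multiplied by
   [1 - (m / 2) t (t^(-1/2) + v)], which lies in [0, 1 - a / M]. *)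
Fixpoint inv_sqrt_poly (m : R) n : {poly R} :=
  if n is n'.+1 then
    inv_sqrt_poly m n' + (m / 2)%:P * (1 - 'X * inv_sqrt_poly m n' ^+ 2)
  else m%:P.

(** The start [m = M^(-1/2)] lies below [t^(-1/2)] for every [t] in [[a, M]], and the iterates stay
    between the two, so the error decays geometrically and uniformly in [t]. *)
Lemma inv_sqrt_poly_approx (a M : R) : 0 < a -> a <= M ->
  uniform_approx [set t | a <= t <= M] (inv_sqrt_poly (M `^ (- 2^-1)))
    (fun t => t `^ (- 2^-1)).
Proof.
move=> a0 aM; have M0 : 0 < M by exact: lt_le_trans aM.
have [] := powR_halfN M0; set m := M `^ _ => m0 mM _.
have [] := powR_halfN a0; set ra := a `^ _ => ra0 raE _.
pose d := 1 - a / M.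
have aM0 : 0 < a / M by rewrite divr_gt0.
have aM1 : a / M <= 1 by rewrite ler_pdivrMr// mul1r.
have d0 : 0 <= d by rewrite subr_ge0.
have d1 : d < 1 by rewrite ltrBlDr ltrDl.
have err n t : a <= t <= M ->
    m <= (inv_sqrt_poly m n).[t] <= t `^ (- 2^-1) /\
    t `^ (- 2^-1) - (inv_sqrt_poly m n).[t] <= ra * d ^+ n.
  move=> /andP[at_ tM]; have t0 : 0 < t by exact: lt_le_trans at_.
  have [] := powR_halfN t0; set r := t `^ _ => r0 rE _.
  have mr : m <= r.
    apply: (ler_of_sqr (ltW r0)); rewrite -(ler_pM2l M0) mM -rE ler_wpM2r//.
    exact: sqr_ge0.
  elim: n => [|n [/andP[mv vr] IH]] /=.
    rewrite hornerC lexx mr expr0 mulr1; split=> //.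
    suff : r <= ra by lra.
    apply: (ler_of_sqr (ltW ra0)); rewrite -(ler_pM2l a0) raE -rE ler_wpM2r//.
    exact: sqr_ge0.
  rewrite hornerD hornerM hornerC hornerD hornerN hornerM horner_exp hornerX.
  rewrite hornerC; move: mv vr IH; set v := (_).[t] => mv vr IH.
  (* [c] is the share of the error removed by one step. From [m <= v <= r], it lies between
     [t m^2 = t / M] and [t m r <= t r^2 = 1]. *)
  pose c := m / 2 * t * (r + v).
  have mt0 : 0 <= m / 2 * t by rewrite !mulr_ge0// ltW.
  have c1 : c <= 1.
    have -> : 1 = t * (r * r) by rewrite -expr2 rE.
    have le1 : c <= m / 2 * t * (r + r) by rewrite ler_wpM2l// lerD2l.
    apply: le_trans le1 _.
    have -> : m / 2 * t * (r + r) = t * (m * r) by field.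
    by rewrite ler_wpM2l ?ler_wpM2r// ltW.
  have ac : a / M <= c.
    have le1 : m / 2 * t * (m + m) <= c by rewrite ler_wpM2l// lerD.
    apply: le_trans le1; have -> : m / 2 * t * (m + m) = t * m ^+ 2 by field.
    rewrite ler_pdivrMr// -mulrA [m ^+ 2 * M]mulrC mM mulr1//.
  have cd : 1 - c <= d by rewrite lerD2l lerN2.
  have vE : m / 2 * (1 - t * v ^+ 2) = (r - v) * c.
    have -> : 1 - t * v ^+ 2 = t * r ^+ 2 - t * v ^+ 2 by rewrite rE.
    by rewrite /c; ring.
  have c0 : 0 <= c by apply: le_trans ac; exact: ltW.
  have rv0 : 0 <= r - v by rewrite subr_ge0.
  rewrite vE; have eE : r - (v + (r - v) * c) = (r - v) * (1 - c) by ring.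
  split; last first.
    by rewrite eE exprSr mulrA ler_pM// subr_ge0.
  have vv : v <= v + (r - v) * c by rewrite lerDl mulr_ge0.
  rewrite (le_trans mv vv)/=.
  by rewrite -subr_ge0 eE mulr_ge0// subr_ge0.
move=> e e0.
have : d ^+ n @[n --> \oo] --> (0 : R) by apply: cvg_expr; rewrite ger0_norm.
move=> /cvgrPdist_le /(_ _ (divr_gt0 e0 ra0)) [N _ Nd]; exists N => n Nn t tS.
have [/andP[_ vr] ve] := err n t tS; rewrite ger0_norm ?subr_ge0//.
apply: le_trans ve _; have := Nd _ Nn; rewrite /= sub0r normrN.
by rewrite ger0_norm ?exprn_ge0// ler_pdivlMr// mulrC.
Qed.

End SquareRoot.

(** * Operator square roots and bounds on the geometric mean *)

Section OperatorSquareRoot.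
Variables (R : realType) (H : hilbertType R).

Lemma opow_half (A : bop H H) (a : R) : symmetric_op A -> 0 < a ->
  bop_le (a *: bid H) A ->
  let S := opow A 2^-1 in let T := opow A (- 2^-1) in
  [/\ symmetric_op S, bop_le 0 S, S \o_B S = A, symmetric_op T &
      inverse_op S T].
Proof.
move=> sA a0 aA S T; pose M := `|A| + a.
have aM : a <= M by rewrite lerDr.
have M0 : 0 < M by exact: lt_le_trans aM.
have spA : spectrum A `<=` [set t | a <= t <= M].
  move=> l Al /=; rewrite (spectrum_coercive aA Al)/=.
  apply: (spectrum_le_bound _ Al); apply: bop_le_trans (bop_le_norm A) _.
  by apply: bop_le_scalar; rewrite lerDl ltW.
have pos l : spectrum A l -> 0 < l.
  by move=> /spA/andP[al _]; exact: lt_le_trans al.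
have approxT := uniform_approx_sub spA (inv_sqrt_poly_approx a0 aM).
have bd l : spectrum A l -> `|l| <= M.
  by move=> Al; rewrite gtr0_norm ?pos//; case/andP: (spA _ Al).
(* [t^(1/2)] is approximated as [t] times [t^(-1/2)]. *)
have approxS := uniform_approxMX bd approxT.
have cT : is_cfc A (fun t => t `^ (- 2^-1)) T by apply: cfcP => //; eexists; exact: approxT.
have cS : is_cfc A (fun t => t `^ 2^-1) S.
  apply: cfcP => //; eexists; apply: eq_uniform_approx approxS.
  by move=> t /pos/powR_halfN[].
(* A common bound for both powers on the spectrum: [r^2 <= a^-1], [(l r)^2 <= M], and [s <= 1 + s^2]
   for every real [s]. *)
pose K := 1 + M + a^-1.
have K0 : 0 < a^-1 by rewrite invr_gt0.
have bound l : spectrum A l -> let r := l `^ (- 2^-1) in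
    [/\ 0 < r, l * r ^+ 2 = 1, r <= K & 0 <= l * r <= K].
  move=> Al; have l0 := pos _ Al; have [r0 rE _] := powR_halfN l0.
  move: (l `^ (- 2^-1)) r0 rE => /= r r0 rE.
  have /andP[al lM] := spA _ Al.
  have rK : r <= K.
    have : r ^+ 2 <= a^-1.
      by rewrite -(ler_pM2l a0) mulfV ?gt_eqF// -rE ler_wpM2r// sqr_ge0.
    rewrite /K; nra.
  split=> //; rewrite mulr_ge0 ?ltW//=.
  have : (l * r) ^+ 2 <= M.
    have -> : (l * r) ^+ 2 = l * (l * r ^+ 2) by ring.
    by rewrite rE mulr1.
  have : 0 <= l * r by rewrite mulr_ge0 ?ltW.
  rewrite /K; nra.
have SS : S \o_B S = bpoly 'X A.
  apply: (is_cfc_mul (K := K) sA cS cS) => l Al.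
  have [r0 rE rK /andP[lr0 lrK]] := bound _ Al.
  have [_ _ ->] := powR_halfN (pos _ Al).
  rewrite ger0_norm// hornerX; split=> //.
  by rewrite mulrACA -expr2 -mulrA rE mulr1.
have ST : S \o_B T = bpoly 1%:P A.
  apply: (is_cfc_mul (K := K) sA cS cT) => l Al.
  have [r0 rE rK /andP[lr0 lrK]] := bound _ Al.
  have [_ _ ->] := powR_halfN (pos _ Al).
  rewrite !ger0_norm//; last exact: ltW.
  by rewrite hornerC -mulrA -expr2.
have TS : T \o_B S = bpoly 1%:P A.
  apply: (is_cfc_mul (K := K) sA cT cS) => l Al.
  have [r0 rE rK /andP[lr0 lrK]] := bound _ Al.
  have [_ _ ->] := powR_halfN (pos _ Al).
  rewrite !ger0_norm//; last exact: ltW.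
  by rewrite hornerC mulrCA -expr2.
split.
- exact: is_cfc_symmetric cS.
- apply: (is_cfc_ge0 (K := K) sA cS) => l Al.
  by have [_ _ ->] := powR_halfN (pos _ Al); have [] := bound _ Al.
- by rewrite SS; apply: bop_eqP => x; rewrite bpolyX.
- exact: is_cfc_symmetric cT.
- split=> x.
    by have := congr1 (fun U : bop H H => U x) TS; rewrite bpolyC scale1r.
  by have := congr1 (fun U : bop H H => U x) ST; rewrite bpolyC scale1r.
Qed.

(** With [X = P^(-1/2) Q P^(-1/2)], [Q <= P] gives [X <= 1], hence [X <= X^(1/2) <= 1]; conjugating
    by [P^(1/2)] gives [Q <= P # Q <= P]. *)
Lemma geomean_between (P Q : bop H H) (q : R) :
  symmetric_op P -> symmetric_op Q -> 0 < q -> bop_le (q *: bid H) Q ->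
  bop_le Q P ->
  [/\ symmetric_op (geomean P Q), bop_le Q (geomean P Q) &
      bop_le (geomean P Q) P].
Proof.
move=> sP sQ q0 qQ QP.
have [] := opow_half sP q0 (bop_le_trans qQ QP); rewrite /geomean.
set S := opow P 2^-1; set T := opow P (- 2^-1) => sS S0 SS sT [ST TS].
set X := T \o_B Q \o_B T.
have sX : symmetric_op X by exact: symmetric_conj.
have X1 : bop_le X (bid H).
  move=> x /=; rewrite sT; apply: le_trans (QP (T x)) _.
  by rewrite -SS /= sS !TS.
have qX : exists2 e, 0 < e & bop_le (e *: bid H) X.
  (* [<X x, x> >= q |T x|^2], and [|x| = |S (T x)| <= (|S| + 1) |T x|]. *)
  exists (q / (`|S| + 1) ^+ 2); first by rewrite divr_gt0// exprn_gt0// ltr_wpDl.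
  move=> x; rewrite bopZE innerZl inner_norm /= sT.
  apply: le_trans (qQ (T x)); rewrite bopZE innerZl inner_norm -mulrA.
  rewrite ler_pM2l// ler_pdivrMl ?exprn_gt0 ?ltr_wpDl//.
  rewrite -exprMn ler_sqr ?nnegrE ?mulr_ge0 ?addr_ge0// -{1}(TS x).
  by rewrite (le_trans (ler_norm_bop _ _))// ler_wpM2r// lerDl.
have [e e0 eX] := qX.
have [] := opow_half sX e0 eX; set Y := opow X 2^-1 => sY Y0 YY _ _.
have Yx x : inner (X x) x = `|Y x| ^+ 2 by rewrite -YY /= sY inner_norm.
have Y1 x : `|Y x| <= `|x|.
  rewrite -ler_sqr ?nnegrE// -Yx (le_trans (X1 x))// inner_norm//.
have nY : `|Y| <= 1 by apply: norm_bop_le => // x; rewrite mul1r.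
have YI : bop_le Y (bid H).
  apply: bop_le_trans (bop_le_norm Y) _.
  by rewrite -[X in bop_le _ X]scale1r; exact: bop_le_scalar.
(* Cauchy-Schwarz for the form of [Y] at [x] and [Y x] gives [|Y x|^4 <= <Y x, x> |Y x|^2], using
   [Y <= 1]. *)
have XY : bop_le X Y.
  move=> x; rewrite Yx; have := positive_cauchy_schwarz x (Y x) sY Y0.
  rewrite inner_norm => h.
  have YYx : inner (Y (Y x)) (Y x) <= `|Y x| ^+ 2.
    by rewrite -inner_norm; exact: YI.
  have [->|Yx0] := eqVneq (Y x) 0.
    by rewrite normr0 expr0n inner0l.
  rewrite -(@ler_pM2r _ (`|Y x| ^+ 2)) ?exprn_gt0 ?normr_gt0// -expr2.
  apply: le_trans h _; rewrite ler_wpM2l//.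
  by have := Y0 x; rewrite inner0l.
split.
- exact: symmetric_conj.
- move=> x /=; rewrite sS; apply: le_trans (XY (S x)) => /=.
  by rewrite sT !ST.
- move=> x /=; rewrite sS; apply: le_trans (YI (S x)) _.
  by rewrite -SS /= (sS (S x) x).
Qed.

End OperatorSquareRoot.

(** * Set-valued operations on graphs of bounded operators *)

Section SetValuedOperators.
Variable R : realType.

Lemma sv_of_inj (H G : normedModType R) (S T : bop H G) :
  sv_of S = sv_of T -> S = T.
Proof.
move=> ST; apply: bop_eqP => x.
by have : sv_of T x (S x) by rewrite -ST.
Qed.

Lemma op_ofE (H G : normedModType R) (T : bop H G) : op_of (sv_of T) = T.
Proof. by apply: xget_unique => // S; exact: sv_of_inj. Qed.

Lemma sv_inv_inverse (H : hilbertType R) (A T : bop H H) : inverse_op A T ->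
  sv_inv (sv_of A) = sv_of T.
Proof.
move=> [AT TA]; apply/funext => y; apply/seteqP; split=> x /= ->.
  by rewrite /sv_of/= AT.
by rewrite /sv_inv /sv_of /= TA.
Qed.

Lemma binvE (H : hilbertType R) (A T : bop H H) : inverse_op A T -> binv A = T.
Proof. by move=> AT; rewrite /binv (sv_inv_inverse AT) op_ofE. Qed.

Lemma sv_comp_of (H G K : normedModType R) (S : bop G K) (T : bop H G) :
  sv_comp (sv_of S) (sv_of T) = sv_of (S \o_B T).
Proof. by apply/funext => x; rewrite /sv_comp bigcup_set1. Qed.

Lemma sv_add_of (H G : normedModType R) (S T : bop H G) :
  sv_add (sv_of S) (sv_of T) = sv_of (S + T).
Proof.
apply/funext => x; apply/seteqP; split=> y /=.
  by move=> [u -> [v -> <-]].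
by move=> ->; exists (S x) => //; exists (T x).
Qed.

Lemma parallel_compE (H G : hilbertType R) (L : bop H G) (D E : bop G G)
    (Q : bop H H) : inverse_op D E ->
  inverse_op (adjoint L \o_B E \o_B L) Q ->
  parallel_comp L (sv_of D) = sv_of Q.
Proof.
move=> DE FQ; rewrite /parallel_comp (sv_inv_inverse DE) !sv_comp_of.
by rewrite -(sv_inv_inverse FQ); congr sv_inv; congr sv_of; apply: bop_eqP.
Qed.

End SetValuedOperators.

(** * Compression by an isometry, parallel composition, and the squeeze *)

Section Isometry.
Variables (R : realType) (H G : hilbertType R) (L : bop H G).
Hypothesis L_isometry : adjoint L \o_B L = bid H.
Implicit Types (C D E : bop G G) (x y : H) (u v : G).

Definition compression C : bop H H := adjoint L \o_B C \o_B L.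

Lemma isometryK x : adjoint L (L x) = x.
Proof. by have := congr1 (fun T : bop H H => T x) L_isometry. Qed.

Lemma inner_adjoint u x : inner (adjoint L u) x = inner u (L x).
Proof. by rewrite innerC -isometry_adjoint// innerC. Qed.

Lemma inner_isometry x y : inner (L x) (L y) = inner x y.
Proof. by rewrite isometry_adjoint// isometryK. Qed.

Lemma inner_compression C x y : inner (compression C x) y = inner (C (L x)) (L y).
Proof. exact: inner_adjoint. Qed.

Lemma compression_symmetric C : symmetric_op C -> symmetric_op (compression C).
Proof.
by move=> sC x y; rewrite inner_compression sC innerC -inner_compression innerC.
Qed.

Lemma compression_le C D : bop_le C D -> bop_le (compression C) (compression D).
Proof. by move=> CD x; rewrite !inner_compression; exact: CD. Qed.

Lemma compressionD C D : compression (C + D) = compression C + compression D.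
Proof. by apply: bop_eqP => x /=; rewrite bop_mapD. Qed.

Lemma compression_scalar a : compression (a *: bid G) = a *: bid H.
Proof. by apply: bop_eqP => x /=; rewrite bop_mapZ isometryK. Qed.

Lemma compression_coercive a C : bop_le (a *: bid G) C ->
  bop_le (a *: bid H) (compression C).
Proof. by move=> /compression_le; rewrite compression_scalar. Qed.

Lemma compression_bounded a C : bop_le C (a *: bid G) ->
  bop_le (compression C) (a *: bid H).
Proof. by move=> /compression_le; rewrite compression_scalar. Qed.

(* [Q] is the parallel composition of [D] by [adjoint L], and [<Q x, x>] is the
   minimum of [<D y, y>] over [adjoint L y = x], attained at [y = E L Q x]. *)
Lemma parallel_spec D (d : R) : symmetric_op D -> 0 < d ->
  bop_le (d *: bid G) D ->
  exists E Q, [/\ inverse_op D E, inverse_op (compression E) Q, symmetric_op Q &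
    bop_le (d *: bid H) Q].
Proof.
move=> sD d0 dD; have [E DE] := coercive_inverse d0 dD.
have D0 : bop_le 0 D by apply: coercive_positive dD; exact: ltW.
have sE := inverse_symmetric DE sD.
have M0 : 0 < `|D| + 1 by rewrite ltr_pwDr.
have DM : bop_le D ((`|D| + 1) *: bid G).
  by apply: bop_le_trans (bop_le_norm D) _; apply: bop_le_scalar; rewrite lerDl.
have ME := compression_coercive (scalar_le_inverse M0 sD D0 DM DE).
have Mi0 : 0 < (`|D| + 1)^-1 by rewrite invr_gt0.
have [Q EQ] := coercive_inverse Mi0 ME.
have sF := compression_symmetric sE.
exists E, Q; split=> //; first exact: inverse_symmetric EQ sF.
rewrite -[d]invrK; apply: (scalar_le_inverse _ sF _ _ EQ).
- by rewrite invr_gt0.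
- exact: coercive_positive (ltW Mi0) ME.
- exact/compression_bounded/(inverse_le_scalar d0 dD DE).
Qed.

(** For [D = C + mu] and [y = E (L (Q x)) = L x + w], the vector [w] is orthogonal to the range of
    [L], which contains [D y]. Hence [<D y, w> = 0] and the gap [d] is [<D w, w>]. *)
Lemma parallel_gap C E (Q : bop H H) (mu : R) : symmetric_op C -> bop_le 0 C ->
  0 < mu -> inverse_op (C + mu *: bid G) E -> inverse_op (compression E) Q ->
  forall x, let d := inner (compression C x) x + mu * inner x x - inner (Q x) x
  in 0 <= d /\ mu * d <= `|C| ^+ 2 * inner x x.
Proof.
move=> sC C0 mu0 [DE ED] [_ FQ] x; set D := C + _ in DE ED.
pose y := E (L (Q x)); pose w := y - L x.
have Lw (h : H) : inner (L h) w = 0.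
  rewrite /w innerBr inner_isometry isometry_adjoint//.
  by rewrite -[adjoint L y]/(compression E (Q x)) FQ subrr.
have Dy : D y = L (Q x) by exact: ED.
have Dyw : inner (D y) w = 0 by rewrite Dy Lw.
have yE : y = L x + w by rewrite /w addrC subrK.
clearbody w.
have DxE u v : inner (D u) v = inner (C u) v + mu * inner u v.
  by rewrite /D !bopE innerDl innerZl.
have CLw : inner (C (L x)) w + inner (D w) w = 0.
  by move: Dyw; rewrite yE bop_mapD innerDl DxE Lw mulr0 addr0.
have dE : inner (compression C x) x + mu * inner x x - inner (Q x) x =
    inner (D w) w.
  have h1 : inner (D (L x)) (L x) = inner (compression C x) x + mu * inner x x.
    by rewrite DxE inner_compression inner_isometry.
  have h2 : inner (Q x) x = inner (D (L x)) (L x) + inner (D w) (L x).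
    by rewrite -(inner_isometry (Q x)) -Dy -innerDl -bop_mapD -yE.
  have h3 : inner (D w) (L x) = inner (C (L x)) w.
    by rewrite DxE (innerC w) Lw mulr0 addr0 sC innerC.
  lra.
rewrite /= dE; have := C0 w; rewrite inner0l => Cw; have w0 := inner_ge0 w.
(* Expanding this square with [<C (L x), w> = - <D w, w>] gives
   [mu <D w, w> + mu <C w, w> <= |C (L x)|^2]. *)
have sq := inner_ge0 (C (L x) + mu *: w).
have CL : inner (C (L x)) (C (L x)) <= `|C| ^+ 2 * inner x x.
  rewrite -(inner_isometry x) !inner_norm -exprMn.
  by rewrite ler_sqr ?nnegrE ?mulr_ge0 ?ler_norm_bop.
have mw : 0 <= mu * inner w w by rewrite mulr_ge0// ltW.
split; first by rewrite DxE addr_ge0.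
rewrite DxE in CLw *; rewrite !innerE (innerC w) in sq.
have h : 0 <= mu * inner (C w) w by rewrite mulr_ge0// ltW.
have := congr1 ( *%R mu) CLw; rewrite mulr0 !mulrDr => CLw'; lra.
Qed.

Lemma calL_pos_spec C (c mu : R) : symmetric_op C -> 0 < c ->
  bop_le (c *: bid G) C -> 0 < mu ->
  exists E Q, [/\ inverse_op (C + mu *: bid G) E, inverse_op (compression E) Q &
   [/\ symmetric_op Q, symmetric_op (calL_pos mu L C),
    bop_le (Q - mu *: bid H) (calL_pos mu L C),
    bop_le (calL_pos mu L C) (compression C) & bop_le (c *: bid H) (Q - mu *: bid H)]].
Proof.
move=> sC c0 cC mu0; set D := C + mu *: bid G.
have sD : symmetric_op D by apply: symmetricD => //; exact: symmetricZ.
have d0 : 0 < c + mu by rewrite addr_gt0.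
have dD : bop_le ((c + mu) *: bid G) D.
  by move=> x; have := cC x; rewrite !bopE !innerE; lra.
have [E [Q [DE EQ sQ dQ]]] := parallel_spec sD d0 dD.
have C0 := coercive_positive (ltW c0) cC.
have gap := parallel_gap sC C0 mu0 DE EQ.
have sP := compression_symmetric sD.
have PE x : inner (compression D x) x = inner (compression C x) x + mu * inner x x.
  by rewrite compressionD compression_scalar !bopE innerDl innerZl.
have QP : bop_le Q (compression D).
  by move=> x; rewrite PE -subr_ge0; have [] := gap x.
have [sK QK KP] := geomean_between sP sQ d0 dQ QP.
have KE : calL_pos mu L C = geomean (compression D) Q - mu *: bid H.
  by rewrite /calL_pos (parallel_compE DE EQ) op_ofE.
exists E, Q; split=> //; rewrite KE; split=> //.
- by apply: symmetricB => //; exact: symmetricZ.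
- by move=> x; have := QK x; rewrite !bopBE !innerBl; lra.
- by move=> x; have := KP x; rewrite PE bopBE bopZE innerBl innerZl /=; lra.
- by move=> x; have := dQ x; rewrite !bopE !innerE /=; lra.
Qed.

(** The lower bound is independent of [mu], so the inverses stay uniformly bounded in the limit at
    -oo. *)
Lemma calL_pos_coercive C (c mu : R) : symmetric_op C -> 0 < c ->
  bop_le (c *: bid G) C -> 0 < mu -> bop_le (c *: bid H) (calL_pos mu L C).
Proof.
move=> sC c0 cC mu0; have [E [Q [_ _ [_ _ QK _ cQ]]]] := calL_pos_spec sC c0 cC mu0.
exact: bop_le_trans cQ QK.
Qed.

Lemma calL_pos_dist C (c mu : R) : symmetric_op C -> 0 < c ->
  bop_le (c *: bid G) C -> 0 < mu ->
  `|compression C - calL_pos mu L C| <= `|C| ^+ 2 / mu.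
Proof.
move=> sC c0 cC mu0.
have [E [Q [DE EQ [_ sK QK KP _]]]] := calL_pos_spec sC c0 cC mu0.
have C0 := coercive_positive (ltW c0) cC.
apply: norm_positive_le.
- by rewrite divr_ge0 ?sqr_ge0 ?ltW.
- by apply: symmetricB => //; exact: compression_symmetric.
- by move=> x; rewrite inner0l bopBE innerBl subr_ge0; exact: KP.
- move=> x; have [_ gap] := parallel_gap sC C0 mu0 DE EQ x.
  have := QK x; rewrite !bopE !innerE /= mulrAC ler_pdivlMr// => h.
  apply: le_trans gap; rewrite mulrC ler_pM2l//; lra.
Qed.

(** The identity [E2 = gamma^-1 (1 - gamma^-1 E1)] passes to the compressions because [L] is an
    isometry. Then [Q2 - gamma] maps [F2 z] to [gamma^-1 F1 z], and [Q1 - gamma^-1] maps this back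
    to [F2 z]. *)
Lemma resolvent_inverse (B Bi E1 E2 : bop G G) (Q1 Q2 : bop H H) (gamma : R) :
  0 < gamma -> inverse_op B Bi ->
  inverse_op (B + gamma^-1 *: bid G) E1 -> inverse_op (compression E1) Q1 ->
  inverse_op (Bi + gamma *: bid G) E2 -> inverse_op (compression E2) Q2 ->
  inverse_op (Q2 - gamma *: bid H) (Q1 - gamma^-1 *: bid H).
Proof.
move=> g0 [BBi BiB] [_ DE1] [F1Q QF1] [DE2 _] [F2Q QF2].
have gn0 : gamma != 0 by rewrite gt_eqF.
have E2E u : E2 u = gamma^-1 *: (u - gamma^-1 *: E1 u).
  have uE : u - gamma^-1 *: E1 u = B (E1 u).
    by apply/eqP; rewrite subr_eq; apply/eqP; rewrite -{1}(DE1 u) !bopE.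
  rewrite uE -[LHS](congr1 E2 (DE1 u)).
  rewrite -[RHS]DE2; congr (E2 _); rewrite !bopE /= bop_mapZ BBi scalerA.
  by rewrite mulfV// scale1r addrC.
have F2E x : compression E2 x = gamma^-1 *: (x - gamma^-1 *: compression E1 x).
  by rewrite /= E2E bop_mapZ bop_mapB bop_mapZ isometryK.
set F1 := compression E1 in F1Q QF1 F2E; set F2 := compression E2 in F2Q QF2 F2E.
split=> x.
  rewrite -(QF2 x); move: (Q2 x) => {x}z.
  have -> : (Q2 - gamma *: bid H) (F2 z) = gamma^-1 *: F1 z.
    rewrite bopBE scalar_bopE F2Q F2E scalerA mulfV// scale1r.
    by rewrite opprB addrC subrK.
  by rewrite bopBE scalar_bopE bop_mapZ F1Q -scalerBr -F2E.
rewrite -(QF1 x); move: (Q1 x) => {x}z.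
have -> : (Q1 - gamma^-1 *: bid H) (F1 z) = gamma *: F2 z.
  by rewrite bopBE scalar_bopE F1Q F2E scalerA mulfV// scale1r.
rewrite bopBE scalar_bopE bop_mapZ F2Q -scalerBr F2E !scalerA mulfV// scale1r.
by rewrite opprB addrC subrK scalerA mulfV// scale1r.
Qed.

End Isometry.

Lemma sv_loewner_of (R : realType) (H : hilbertType R) (S T : bop H H) :
  symmetric_op S -> symmetric_op T -> bop_le S T ->
  sv_loewner (sv_of S) (sv_of T).
Proof. by move=> sS sT ST; exists S, T; split=> //; apply/loewnerP. Qed.

(** * The chain of inequalities and the two limits *)

Section ResolventMeans.
Variables (R : realType) (H G : hilbertType R) (L : bop H G).
Hypothesis L_isometry : adjoint L \o_B L = bid H.

Lemma resolvent_cocompE (B Bi E : bop G G) (Q T : bop H H) (gamma : R) :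
  inverse_op B Bi -> inverse_op (Bi + gamma *: bid G) E ->
  inverse_op (compression L E) Q -> inverse_op (Q - gamma *: bid H) T ->
  resolvent_cocomp gamma L (sv_of B) = sv_of T.
Proof.
move=> BBi DE FQ QT; rewrite /resolvent_cocomp /resolvent_comp invrK.
rewrite (sv_inv_inverse BBi) sv_add_of (parallel_compE DE FQ) sv_add_of.
exact: sv_inv_inverse.
Qed.

Lemma calL_chain (B Bi : bop G G) (b bi gamma : R) (P : bop H H) :
  symmetric_op B -> 0 < b -> bop_le (b *: bid G) B ->
  inverse_op B Bi -> 0 < bi -> bop_le (bi *: bid G) Bi ->
  inverse_op (compression L Bi) P -> 0 < gamma ->
  [/\ sv_loewner (sv_of P) (sv_of (calL (- gamma) L B)),
      sv_loewner (sv_of (calL (- gamma) L B))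
                 (resolvent_cocomp gamma L (sv_of B)),
      sv_loewner (resolvent_cocomp gamma L (sv_of B))
                 (sv_of (calL gamma^-1 L B)) &
      sv_loewner (sv_of (calL gamma^-1 L B)) (sv_of (compression L B))].
Proof.
move=> sB b0 bB BBi bi0 biBi FP g0.
have sBi := inverse_symmetric BBi sB.
have gi0 : 0 < gamma^-1 by rewrite invr_gt0.
have [E1 [Q1 [DE1 FQ1 [sQ1 sK1 QK1 KB1 _]]]] :=
  calL_pos_spec L_isometry sB b0 bB gi0.
have [E2 [Q2 [DE2 FQ2 [sQ2 sK2 QK2 KB2 biQ2]]]] :=
  calL_pos_spec L_isometry sBi bi0 biBi g0.
have biK2 := bop_le_trans biQ2 QK2.
have [N KN] := coercive_inverse bi0 biK2.
have QQ := resolvent_inverse L_isometry g0 BBi DE1 FQ1 DE2 FQ2.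
have -> : calL (- gamma) L B = N.
  by rewrite /calL ltNge oppr_le0 (ltW g0)/= opprK (binvE BBi) (binvE KN).
have -> : calL gamma^-1 L B = calL_pos gamma^-1 L B by rewrite /calL gi0.
rewrite (resolvent_cocompE BBi DE2 FQ2 QQ).
have sN := inverse_symmetric KN sK2.
have sQg : symmetric_op (Q1 - gamma^-1 *: bid H).
  by apply: symmetricB => //; exact: symmetricZ.
have sQg2 : symmetric_op (Q2 - gamma *: bid H).
  by apply: symmetricB => //; exact: symmetricZ.
(* The first two comparisons invert the squeeze for [Bi]; the last two are the squeeze for [B],
   already in context up to symmetry. *)
split; apply: sv_loewner_of => //.
- exact: inverse_symmetric FP (compression_symmetric L_isometry sBi).
- exact: inverse_antitone sK2 (coercive_positive (ltW bi0) biK2) KB2 KN FP.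
- exact: inverse_antitone sQg2 (coercive_positive (ltW bi0) biQ2) QK2 QQ KN.
- exact: compression_symmetric.
Qed.

Lemma calL_cvg_pinfty (B : bop G G) (b : R) :
  symmetric_op B -> 0 < b -> bop_le (b *: bid G) B ->
  calL g L B @[g --> +oo] --> compression L B.
Proof.
move=> sB b0 bB; apply/cvgrPdist_le => e e0.
exists (`|B| ^+ 2 / e); split; first exact: num_real.
move=> g /= gB.
have g0 : 0 < g by apply: le_lt_trans gB; rewrite divr_ge0 ?sqr_ge0// ltW.
rewrite /calL g0 (le_trans (calL_pos_dist L_isometry sB b0 bB g0))//.
by rewrite ler_pdivrMr// mulrC -ler_pdivrMr// ltW.
Qed.

(** Resolvent identity [P - N = P (K - F) N] with [|N| <= c^-1]; only [K] varies in the application,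
    with [c] fixed. *)
Lemma norm_inverse_sub (F K P N : bop H H) (c : R) : 0 < c ->
  bop_le (c *: bid H) K -> inverse_op F P -> inverse_op K N ->
  `|P - N| <= `|P| * `|F - K| / c.
Proof.
move=> c0 cK [FP PF] [KN NK].
have Nc : `|N| <= c^-1.
  apply: norm_bop_le => [|x]; first by rewrite invr_ge0 ltW.
  by rewrite ler_pdivlMl// (le_trans (coercive_lower_bound _ cK))// NK.
have -> : P - N = P \o_B (K - F) \o_B N.
  by apply: bop_eqP => x; rewrite -[RHS]/(P ((K - F) (N x))) !bopBE NK bop_mapB FP.
rewrite (le_trans (norm_bcomp _ _))// ler_pM// distrC; exact: norm_bcomp.
Qed.

Lemma calL_cvg_ninfty (B Bi : bop G G) (bi : R) (P : bop H H) :
  symmetric_op B -> inverse_op B Bi -> 0 < bi -> bop_le (bi *: bid G) Bi ->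
  inverse_op (compression L Bi) P ->
  calL g L B @[g --> -oo] --> P.
Proof.
move=> sB BBi bi0 biBi FP; apply/cvgrPdist_le => e e0.
have sBi := inverse_symmetric BBi sB.
(* [norm_inverse_sub] and [calL_pos_dist] with [mu = - g] bound the distance by [c / (- g)]. *)
set c := `|P| * `|Bi| ^+ 2 / bi.
exists (- (c / e)); split; first exact: num_real.
move=> g /= gc.
have c0 : 0 <= c by rewrite divr_ge0 ?mulr_ge0 ?sqr_ge0// ltW.
have g0 : 0 < - g.
  rewrite oppr_gt0 (lt_le_trans gc)//.
  by rewrite oppr_le0 divr_ge0// ltW.
have biK := calL_pos_coercive L_isometry sBi bi0 biBi g0.
have [N KN] := coercive_inverse bi0 biK.
have -> : calL g L B = N.
  by rewrite /calL ltNge -oppr_ge0 (ltW g0)/= (binvE BBi) (binvE KN).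
rewrite (le_trans (norm_inverse_sub bi0 biK FP KN))//.
have dist := calL_pos_dist L_isometry sBi bi0 biBi g0.
apply: (@le_trans _ _ (c / - g)).
  rewrite /c [leRHS]mulrAC ler_wpM2r ?invr_ge0 ?(ltW bi0)// -[leRHS]mulrA ler_wpM2l//.
by rewrite ler_pdivrMr// mulrC -ler_pdivrMr// ltW// ltrNr.
Qed.

End ResolventMeans.

Unset Implicit Arguments.

Theorem proposition5p1 (R : realType) (H G : hilbertType R)
    (L : bop H G) (B : bop G G) (gamma : R)
    (L_isometry : adjoint L \o_B L = bid H)
    (B_strongly_positive : strongly_positive_op B)
    (gamma_gt0 : 0 < gamma) :
  [/\ [/\ sv_loewner (parallel_comp L (sv_of B)) (sv_of (calL (- gamma) L B)),
          sv_loewner (sv_of (calL (- gamma) L B))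
                     (resolvent_cocomp gamma L (sv_of B)),
          sv_loewner (resolvent_cocomp gamma L (sv_of B))
                     (sv_of (calL gamma^-1 L B))
        & sv_loewner (sv_of (calL gamma^-1 L B))
                     (sv_of (adjoint L \o_B B \o_B L))],
      calL g L B @[g --> +oo] --> adjoint L \o_B B \o_B L
    & calL g L B @[g --> -oo] --> op_of (parallel_comp L (sv_of B))].
Proof.
have [_ [b b0 /loewnerP[_ sB bB]]] := B_strongly_positive.
have [Bi [P [BBi FP _ _]]] := parallel_spec L_isometry sB b0 bB.
have B0 := coercive_positive (ltW b0) bB.
(* The summand 1 keeps the bound invertible when [B = 0], which occurs on the trivial space. *)
have M0 : 0 < `|B| + 1 by rewrite ltr_pwDr.
have BM : bop_le B ((`|B| + 1) *: bid G).
  by apply: bop_le_trans (bop_le_norm B) _; apply: bop_le_scalar; rewrite lerDl.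
have biBi := scalar_le_inverse M0 sB B0 BM BBi.
have bi0 : 0 < (`|B| + 1)^-1 by rewrite invr_gt0.
rewrite (parallel_compE BBi FP) op_ofE; split.
- exact: calL_chain sB b0 bB BBi bi0 biBi FP gamma_gt0.
- exact: calL_cvg_pinfty sB b0 bB.
- exact: calL_cvg_ninfty sB BBi bi0 biBi FP.
Qed.
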